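(* For an integer $k\ge 2$, let $$\beta_k^{\mathrm{2nd}}\equiv \inf_{q\in(0,1)}\sqrt{-\frac{1}{q^k}\log(1-q^2)}\,.$$ Let $\beta\ge 0$ be fixed (independent of $n$) and assume $\beta<\beta_k^{\mathrm{2nd}}$. Then, for any $k\ge 3$, $$\lim_{n\to\infty}\big\|\mathbb{P}_\beta-\mathbb{P}_0\big\|_{\mathrm{TV}}=0\,.$$ Further, for $k=2$ and $\beta<\beta_2^{\mathrm{2nd}}=1$, $\mathbb{P}_\beta$ is contiguous with respect to $\mathbb{P}_0$ (as $n\to\infty$).
   Context: Let $\mathbf{G}\in\bigotimes^k\mathbb{R}^n$ be a tensor with i.i.d. entries $\mathbf{G}_{i_1,\dots,i_k}\sim\mathsf{N}(0,1)$. For a permutation $\pi\in\mathfrak{S}_k$ let $\mathbf{G}^\pi$ be the tensor with permuted indices, $\mathbf{G}^\pi_{i_1,\dots,i_k}=\mathbf{G}_{i_{\pi(1)},\dots,i_{\pi(k)}}$. The symmetric standard normal noise tensor is $$\mathbf{Z}=\frac{1}{k!}\sqrt{\frac{2}{n}}\sum_{\pi\in\mathfrak{S}_k}\mathbf{G}^\pi\in\bigotimes^k\mathbb{R}^n .$$ Given $\beta\in\mathbb{R}_{\ge 0}$, let $\mathbf{X}=\beta\,\mathbf{v}^{\otimes k}+\mathbf{Z}$, where $\mathbf{v}$ is uniformly distributed on the unit sphere $\mathbb{S}^{n-1}=\{\mathbf{x}\in\mathbb{R}^n:\|\mathbf{x}\|_2=1\}$ and independent of $\mathbf{Z}$, and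 $\mathbf{v}^{\otimes k}$ is the $k$-th outer power of $\mathbf{v}$. Let $\mathbb{P}_\beta=\mathbb{P}_\beta^{(k)}$ (depending also on $n$) denote the law of $\mathbf{X}$; thus $\mathbb{P}_0$ is the law of $\mathbf{Z}$. Total variation distance: $\|\mathbb{P}-\mathbb{Q}\|_{\mathrm{TV}}=\sup_A|\mathbb{P}(A)-\mathbb{Q}(A)|$, the supremum being over measurable sets. Contiguity: for each $n$ let $\mathbb{P}_{0,n},\mathbb{P}_{1,n}$ be two probability measures on the same measurable space $(\Omega_n,\mathcal{F}_n)$. The sequence $(\mathbb{P}_{1,n})$ is contiguous with respect to $(\mathbb{P}_{0,n})$ if for any sequence of events $A_n\in\mathcal{F}_n$, $\lim_{n\to\infty}\mathbb{P}_{0,n}(A_n)=0$ implies $\lim_{n\to\infty}\mathbb{P}_{1,n}(A_n)=0$. Contiguity of $\mathbb{P}_\beta$ with respect to $\mathbb{P}_0$ refers to the corresponding sequences indexed by $n$. *)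

(* Defs.v *)
From HB Require Import structures.
From mathcomp Require Import all_boot all_order all_algebra all_fingroup.
From mathcomp Require Import all_classical all_reals all_analysis.
From mathcomp Require Import measurable_realfun.

Set Implicit Arguments.
Unset Strict Implicit.
Unset Printing Implicit Defensive.

Import Order.TTheory GRing.Theory Num.Theory.
Import numFieldNormedType.Exports.

Local Open Scope classical_set_scope.
Local Open Scope ring_scope.

Section product_space.
Variables (R : realType) (I : finType).

Definition cylinders : set (set (I -> R)) :=
  [set A | exists i : I, exists2 B : set R,
     measurable B & A = (fun x => x i) @^-1` B].

(* R^I with its product sigma-algebra, which for finite I is the Borel one. *)
Definition RI : measurableType cylinders.-sigma := g_sigma_algebraType cylinders.

Lemma measurable_coord (i : I) : measurable_fun [set: RI] (fun x : RI => x i).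
Proof.
move=> _ B mB; rewrite setTI; apply: sub_sigma_algebra.
by exists i, B.
Qed.

Lemma measurable_RI d (T : measurableType d) (f : T -> RI) :
  (forall i, measurable_fun [set: T] (fun w => f w i)) ->
  measurable_fun [set: T] f.
Proof.
move=> mf; apply: (@measurability _ _ T RI setT f cylinders) => //.
move=> _ [_ [i [B mB ->]] <-].
by have := mf i measurableT B mB.
Qed.

End product_space.

Definition vec (R : realType) (n : nat) := RI R 'I_n.

(* An element of the k-th tensor power of R^n is its array of entries, indexed
   by the multi-indices (i_1, ..., i_k). *)
Definition multi_index (k n : nat) : finType := {ffun 'I_k -> 'I_n}.
Definition tensor (R : realType) (k n : nat) := RI R (multi_index k n).

Section tensors.
Variables (R : realType) (k n : nat).

Definition outer_power (v : vec R n) : tensor R k n :=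
  fun i : multi_index k n => \prod_(j < k) v (i j).

Definition perm_tensor (s : 'S_k) (G : tensor R k n) : tensor R k n :=
  fun i : multi_index k n => G [ffun j => i (s j)].

Definition sym_noise (G : tensor R k n) : tensor R k n :=
  fun i : multi_index k n =>
    (k`!%:R)^-1 * Num.sqrt (2 / n%:R) * \sum_(s : 'S_k) perm_tensor s G i.

Definition spiked_tensor (beta : R) (v : vec R n) (Z : tensor R k n) :
    tensor R k n :=
  fun i : multi_index k n => beta * outer_power v i + Z i.

End tensors.

Section random_tensors.
Variables (R : realType) (k n : nat) (d : measure_display).
Variables (T : measurableType d) (P : probability T R).
Variables (G : {RV P >-> tensor R k n}) (v : {RV P >-> vec R n}).

Definition noise (w : T) : tensor R k n := sym_noise (G w).

Lemma measurable_noise : measurable_fun [set: T] noise.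
Proof.
apply: measurable_RI => i; apply: measurable_funM => //.
apply: measurable_sum => s.
apply: (measurableT_comp (measurable_coord [ffun j => i (s j)])).
exact: measurable_funP.
Qed.

HB.instance Definition _ :=
  isMeasurableFun.Build _ _ _ _ noise measurable_noise.

Definition observation (beta : R) (w : T) : tensor R k n :=
  spiked_tensor beta (v w) (noise w).

Lemma measurable_observation beta : measurable_fun [set: T] (observation beta).
Proof.
apply: measurable_RI => i; apply: measurable_funD; last first.
  exact: (measurableT_comp (measurable_coord i) measurable_noise).
apply: measurable_funM => //; apply: measurable_prod => j _.
apply: (measurableT_comp (measurable_coord (i j))).
exact: measurable_funP.
Qed.

HB.instance Definition _ beta :=
  isMeasurableFun.Build _ _ _ _ (observation beta) (measurable_observation beta).

End random_tensors.

Section probability_notions.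
Variables (R : realType) (d : measure_display) (T : measurableType d).

Definition independent_RVs (P : probability T R)
    d1 (T1 : measurableType d1) d2 (T2 : measurableType d2)
    (X : T -> T1) (Y : T -> T2) : Prop :=
  forall A B, measurable A -> measurable B ->
    P (X @^-1` A `&` Y @^-1` B) = (P (X @^-1` A) * P (Y @^-1` B))%E.

Definition mutually_independent (P : probability T R) (I : finType)
    (X : T -> RI R I) : Prop :=
  forall (J : {set I}) (B : I -> set R), (forall i, measurable (B i)) ->
    P [set w | forall i, i \in J -> B i (X w i)] =
    (\prod_(i in J) fine (P [set w | B i (X w i)]))%:E.

Definition iid_std_normal (P : probability T R) (I : finType)
    (X : T -> RI R I) : Prop :=
  (forall i (B : set R), measurable B ->
     P [set w | B (X w i)] = normal_prob 0 1 B)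
  /\ mutually_independent P X.

Definition tv_dist (P Q : probability T R) : \bar R :=
  ereal_sup [set `|P A - Q A|%E | A in [set A : set T | measurable A]].

End probability_notions.

Section uniform_sphere.
Variables (R : realType) (n : nat).

Definition unit_sphere : set (vec R n) := [set x | \sum_(i < n) x i ^+ 2 = 1].

Definition mx_act (O : 'M[R]_n) (x : vec R n) : vec R n :=
  fun i : 'I_n => \sum_(j < n) O i j * x j.

(* The uniform distribution on the sphere is the unique probability measure
   carried by it that is invariant under the orthogonal group O(n). *)
Definition uniform_on_sphere (mu : probability (vec R n) R) : Prop :=
  mu unit_sphere = 1%E /\
  forall O : 'M[R]_n, O *m O^T = 1%:M ->
    forall A : set (vec R n), measurable A -> mu (mx_act O @^-1` A) = mu A.

End uniform_sphere.

Definition contiguous (R : realType) (d : nat -> measure_display)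
    (T : forall n, measurableType (d n)) (P1 P0 : forall n, probability (T n) R) :
    Prop :=
  forall A : forall n, set (T n), (forall n, measurable (A n)) ->
    P0 n (A n) @[n --> \oo] --> 0%E -> P1 n (A n) @[n --> \oo] --> 0%E.

Definition spiked_model (R : realType) (k n : nat) (d : measure_display)
    (T : measurableType d) (P : probability T R)
    (G : {RV P >-> tensor R k n}) (v : {RV P >-> vec R n}) : Prop :=
  [/\ iid_std_normal P G,
      uniform_on_sphere (distribution P v) &
      independent_RVs P v (noise G)].

Definition spiked_law (R : realType) (k n : nat) (d : measure_display)
    (T : measurableType d) (P : probability T R)
    (G : {RV P >-> tensor R k n}) (v : {RV P >-> vec R n}) (beta : R) :
    probability (tensor R k n) R :=
  distribution P (observation G v beta).

Definition beta2nd (R : realType) (k : nat) : R :=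
  inf [set Num.sqrt (- (q ^+ k)^-1 * ln (1 - q ^+ 2)) | q in `]0, 1[%classic].

(* Main.v *)
(** The likelihood ratio of the spiked model is L(g) = E_v exp(<u_v, g> - |u_v|^2 / 2)
    with u_v = beta (n / 2)^(1/2) v^{(x) k}: adding the spike shifts the Gaussian
    tensor g before symmetrization.  Its second moment is
    M_n = E exp (n beta^2 <v, v'>^k / 2), and for every t > 0
      P_beta(A) <= (1 + t / 2) P_0(A) + (M_n - 1) / (2 t),
    so the total variation distance vanishes when M_n -> 1, and contiguity holds when
    M_n is bounded.  By rotation invariance <v, v'> may be replaced by a coordinate q
    of v, whose even moments are products of (2 j + 1) / (n + 2 j).  For k = 2,
    summing the exponential series gives M_n <= 1 / (1 - beta^2).  For k >= 3, q^k is
    at most eta q^2 when |q| <= eta, and when |q| > eta the threshold condition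
    bounds the integrand by an exponentially small multiple of (1 - q^2)^(-N) with
    N close to n / 2, whose expectation is at most n. *)

From HB Require Import structures.
Require Import Defs.
From mathcomp Require Import all_boot all_order all_algebra all_fingroup.
From mathcomp Require Import all_classical all_reals all_analysis.
From mathcomp Require Import measurable_realfun ring lra zify.

Set Implicit Arguments.
Unset Strict Implicit.
Unset Printing Implicit Defensive.

Import Order.TTheory GRing.Theory Num.Theory.
Import numFieldNormedType.Exports.

Local Open Scope classical_set_scope.
Local Open Scope ring_scope.

(** * Integration against a measure given by a density *)

Section density.
Local Open Scope ereal_scope.
Context d (T : measurableType d) (R : realType).
Variables (mu nu : {measure set T -> \bar R}) (f : T -> R).
Hypothesis mf : measurable_fun [set: T] f.
Hypothesis f0 : forall x, (0 <= f x)%R.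
Hypothesis nuE : forall A, measurable A -> nu A = \int[mu]_(x in A) (f x)%:E.

Import HBNNSimple.

Let integral_density_indic A : measurable A ->
  \int[nu]_x (\1_A x)%:E = \int[mu]_x ((\1_A x)%:E * (f x)%:E).
Proof.
move=> mA; rewrite integral_indic// setIT nuE// integral_mkcond.
apply: eq_integral => x _; rewrite patchE indicE.
by case: ifPn => xA; rewrite ?mul1e ?mul0e.
Qed.

Let integral_density_nnsfun (h : {nnsfun T >-> R}) :
  \int[nu]_x (h x)%:E = \int[mu]_x ((h x)%:E * (f x)%:E).
Proof.
under [LHS]eq_integral do rewrite fimfunE -fsumEFin//.
rewrite [LHS]ge0_integral_fsum//; last 2 first.
  - by move=> r; exact/measurable_EFinP/measurableT_comp.
  - by move=> n x _; rewrite EFinM nnfun_muleindic_ge0.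
under [RHS]eq_integral.
  move=> x xD; rewrite fimfunE -fsumEFin// ge0_mule_fsuml; last first.
    by move=> r; rewrite EFinM nnfun_muleindic_ge0.
  over.
rewrite [RHS]ge0_integral_fsum//; last 2 first.
  - move=> r; apply: emeasurable_funM; last exact/measurable_EFinP.
    by apply/measurable_EFinP; apply: measurable_funM.
  - by move=> n x _; rewrite mule_ge0 ?EFinM ?nnfun_muleindic_ge0// lee_fin.
apply: eq_fsbigr => r _.
have [r0|r0] := ltP r 0%R.
  rewrite preimage_nnfun0//.
  by rewrite !integral0_eq// => x _; rewrite indic0 mulr0 ?mul0e.
under eq_integral do rewrite EFinM.
rewrite ge0_integralZl ?lee_fin//; last first.
  exact/measurable_EFinP/measurable_indic.
rewrite integral_density_indic// -ge0_integralZl ?lee_fin//.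
- by apply: eq_integral => x _; rewrite EFinM muleA.
- by apply: emeasurable_funM => //; exact/measurable_EFinP.
- by move=> x _; rewrite mule_ge0// lee_fin.
Qed.

(** Monotone convergence extends the identity from simple functions. The density stays arbitrary
    because it is later a normal density, an indicator, a constant and an exponential tilt. *)
Lemma ge0_integral_density g : measurable_fun [set: T] g -> (forall x, 0 <= g x) ->
  \int[nu]_x g x = \int[mu]_x (g x * (f x)%:E).
Proof.
move=> mg g0; pose g_ := nnsfun_approx measurableT mg.
have gE x : g x = limn (fun n => (g_ n x)%:E).
  by apply/esym/cvg_lim => //; exact: cvg_nnsfun_approx.
transitivity (limn (fun n => \int[nu]_x (g_ n x)%:E)).
  rewrite -monotone_convergence//=.
  - exact: eq_integral.
  - by move=> n; apply: measurableT_comp.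
  - by move=> n x _; rewrite lee_fin.
  - by move=> x _ a b ab; rewrite lee_fin//; exact/lefP/nd_nnsfun_approx.
under eq_fun do rewrite integral_density_nnsfun.
rewrite -monotone_convergence//=.
- apply: eq_integral => x _; apply: cvg_lim => //.
  by apply: cvgeZr => //; exact: cvg_nnsfun_approx.
- by move=> n; apply: emeasurable_funM => //; apply: measurableT_comp.
- by move=> n x _; rewrite mule_ge0 ?lee_fin.
- move=> x _ a b ab; apply: lee_wpmul2r; first by rewrite lee_fin.
  by rewrite lee_fin; exact/lefP/nd_nnsfun_approx.
Qed.

End density.

(** * Translation in one dimension *)

Section shifts.
Local Open Scope ereal_scope.
Context (R : realType).
Local Notation lambda := (@lebesgue_measure R).

(** Lebesgue measure is determined by its values on half-open intervals, and translation preserves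
    their length. *)
Lemma lebesgue_measure_shift (s : R) (A : set (measurableTypeR R)) :
  measurable A ->
  lambda ((fun x => x + s)%R @^-1` A) = lambda A.
Proof.
pose T := measurableTypeR R.
have ms : measurable_fun [set: T] (fun x : T => (x + s)%R : T).
  exact: measurable_funD.
move=> mA; rewrite -[LHS]/(pushforward lambda (fun x : T => (x + s)%R : T) A).
symmetry; apply: lebesgue_measure_unique => // _ [[a b]] /= _ <-.
rewrite /pushforward.
have -> : (fun x : R => (x + s)%R) @^-1` `]a, b] = `](a - s)%R, (b - s)%R]%classic.
  by apply/seteqP; split => x /=; rewrite !in_itv/= ltrBlDr lerBrDr.
rewrite !lebesgue_measure_itv/= !lte_fin ltrD2r.
by case: ifP => // _; rewrite -!EFinB; congr (_%:E); ring.
Qed.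

(** The quotient of the normal densities at x - s and at x is exp(s x - s^2 / 2): the
    one-dimensional Cameron-Martin formula. *)
Lemma normal_prob_shift (s : R) (B : set R) : measurable B ->
  normal_prob 0 1 ((fun x => x + s)%R @^-1` B) =
  \int[normal_prob 0 1]_(x in B) (expR (s * x - s ^+ 2 / 2))%:E.
Proof.
pose T := measurableTypeR R.
have ms : measurable_fun [set: T] (fun x : T => (x + s)%R : T).
  exact: measurable_funD.
move=> mB.
have mp : measurable_fun [set: T] (fun x => (normal_pdf 0 1 x : R)).
  exact: measurable_normal_pdf.
have mps : measurable_fun [set: T] (fun x => (normal_pdf 0 1 (x - s)%R : R)).
  by apply: measurableT_comp => //; exact: measurable_funB.
have me : measurable_fun [set: R] (fun x : R => expR (s * x - s ^+ 2 / 2)%R).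
  apply: measurableT_comp => //; apply: measurable_funB => //.
transitivity (\int[lambda]_(x in B) (normal_pdf 0 1 (x - s)%R)%:E).
  transitivity (\int[pushforward lambda (fun x : T => (x + s)%R : T)]_(x in B)
                   (normal_pdf 0 1 (x - s)%R)%:E).
    rewrite ge0_integral_pushforward//.
    - by apply: eq_integral => x _ /=; rewrite addrK.
    - by apply/measurable_EFinP; apply: measurable_funTS.
    - by move=> x _; rewrite lee_fin normal_pdf_ge0.
  by apply: eq_measure_integral => A mA _; exact: lebesgue_measure_shift.
rewrite [RHS]integral_mkcond (@ge0_integral_density _ _ _ lambda _ (normal_pdf 0 1))//.
- rewrite [LHS]integral_mkcond; apply: eq_integral => x _; rewrite !patchE.
  case: ifPn => _; rewrite ?mul0e// -EFinM; congr (_%:E).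
  rewrite normal_pdfE ?oner_neq0// mulrCA; congr (_ * _)%R.
  rewrite /normal_fun -expRD; congr (expR _).
  by rewrite !subr0 expr1n; field.
- by move=> x; exact: normal_pdf_ge0.
- apply/(measurable_restrictT _ _).1 => //.
  by apply/measurable_EFinP; exact: measurable_funTS.
- by move=> x; rewrite patchE; case: ifPn => // _; rewrite lee_fin expR_ge0.
Qed.
End shifts.

(** * Measures on finite products and the Gaussian law *)

Section product_laws.
Local Open Scope ereal_scope.
Context (R : realType).

(** Bundles a tilted measure as a measure, so that uniqueness of measures can be applied to it. *)
Lemma density_measure d (T : measurableType d) (mu : {measure set T -> \bar R})
    (f : T -> R) : measurable_fun [set: T] f -> (forall x, (0 <= f x)%R) ->
  exists nu : {measure set T -> \bar R},
    forall A, nu A = \int[mu]_(x in A) (f x)%:E.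
Proof.
move=> mf f0; pose nu (A : set T) := \int[mu]_(x in A) (f x)%:E.
have nu0 : nu set0 = 0 by exact: integral_set0.
have nu_ge0 A : 0 <= nu A by apply: integral_ge0 => x _; rewrite lee_fin.
have nu_sadd : semi_sigma_additive nu.
  by apply: semi_sigma_additive_nng_induced => //; exact/measurable_EFinP.
pose M := isMeasure.Build _ _ _ nu nu0 nu_ge0 nu_sadd.
by exists (HB.pack_for {measure set T -> \bar R} nu M).
Qed.

Variable I : finType.
Implicit Types (B : I -> set R) (x : RI R I).

Lemma measurable_box B : (forall i, measurable (B i)) ->
  measurable [set x : RI R I | forall i, B i (x i)].
Proof.
move=> mB.
have -> : [set x : RI R I | forall i, B i (x i)] =
    \bigcap_(i in [set: I]) ((fun x : RI R I => x i) @^-1` B i).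
  by apply/seteqP; split => [x Bx i _|x Bx i]; [exact: Bx|exact: Bx].
apply: fin_bigcap_measurable => [|i _]; first exact: finite_finset.
by rewrite -[X in measurable X]setTI; exact: (@measurable_coord R I).
Qed.

(** Boxes are stable under intersection and generate the product sigma-algebra. *)
Lemma RI_measure_unique (m1 m2 : {measure set (RI R I) -> \bar R}) :
  m1 [set: RI R I] < +oo ->
  (forall B, (forall i, measurable (B i)) ->
    m1 [set x | forall i, B i (x i)] = m2 [set x | forall i, B i (x i)]) ->
  forall A, measurable A -> m1 A = m2 A.
Proof.
move=> m1oo m12.
pose boxes : set (set (RI R I)) := [set A | exists2 B : I -> set R,
  (forall i, measurable (B i)) & A = [set x | forall i, B i (x i)]].
apply: (@measure_unique _ _ _ boxes (fun=> setT)) => //.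
- apply/seteqP; split.
    apply: sub_sigma_algebra2.
    move=> _ [i [C mC ->]]; exists (fun j => if j == i then C else setT).
      by move=> j; case: ifP.
    apply/seteqP; split => x /=; last by move/(_ i); rewrite eqxx.
    by move=> Cx j; case: eqP => [->|].
  apply: smallest_sub; first exact: sigma_algebra_measurable.
  by move=> _ [B mB ->]; exact: measurable_box.
- move=> _ _ [B mB ->] [C mC ->]; exists (fun i => B i `&` C i).
    by move=> i; exact: measurableI.
  apply/seteqP; split => x /=; first by move=> [Bx Cx] i.
  by move=> BC; split => i; have [] := BC i.
- move=> _; exists (fun=> setT) => //.
  by apply/seteqP; split.
- exact: bigcup_const.
- by move=> _ [B mB ->]; exact: m12.
Qed.

(** Only full boxes are prescribed: by [RI_measure_unique] they determine the law. *)
Definition gaussian_law (g : probability (RI R I) R) : Prop :=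
  forall B, (forall i, measurable (B i)) ->
    g [set x | forall i, B i (x i)] =
    (\prod_i fine (normal_prob 0 1 (B i)))%:E.

End product_laws.

Lemma gaussian_law_iid (R : realType) (I : finType) d (T : measurableType d)
    (P : probability T R) (X : {RV P >-> RI R I}) :
  iid_std_normal P X -> gaussian_law (distribution P X).
Proof.
move=> [mX iX] B mB; rewrite /distribution /pushforward.
transitivity (P [set w | forall i, i \in [set: I]%SET -> B i (X w i)]).
  congr (P _); apply/seteqP; split => w /=.
    by move=> BX i _.
  by move=> BX i; apply: BX; rewrite finset.inE.
rewrite iX//; congr (_%:E); apply: eq_big => i; first by rewrite finset.inE.
by move=> _; rewrite mX.
Qed.

(** * The Cameron-Martin formula for the Gaussian law on R^I *)

Section gaussian_shift.
Local Open Scope ereal_scope.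
Context (R : realType) (I : finType) (g : probability (RI R I) R).
Hypothesis gaussian_g : gaussian_law g.
Implicit Types (x u : RI R I) (F : RI R I -> \bar R).

Definition translate u x : RI R I := fun i => (x i + u i)%R.

Lemma measurable_translate u : measurable_fun [set: RI R I] (translate u).
Proof.
apply: measurable_RI => i; apply: measurable_funD => //.
exact: (@measurable_coord R I).
Qed.

Let tilt1 i (s : R) x : R := expR (s * x i - s ^+ 2 / 2).

Let measurable_tilt1 i s : measurable_fun [set: RI R I] (tilt1 i s).
Proof.
apply: measurableT_comp => //; apply: measurable_funB => //.
by apply: measurable_funM => //; exact: (@measurable_coord R I).
Qed.

(* Fixing all coordinates but the [i]-th in a box leaves a multiple of the
   one-dimensional normal law. *)
Let integral_box_tilt1 i (s : R) (B : I -> set R) :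
  (forall j, measurable (B j)) ->
  \int[g]_(x in [set x | forall j, B j (x j)]) (tilt1 i s x)%:E =
  (\int[normal_prob 0 1]_(t in B i) (expR (s * t - s ^+ 2 / 2))%:E) *
  (\prod_(j | j != i) fine (normal_prob 0 1 (B j)))%:E.
Proof.
move=> mB; set c := (\prod_(j | j != i) _)%R.
have c0 : (0 <= c)%R by apply: prodr_ge0 => j _; exact: fine_ge0.
pose E := [set x : RI R I | forall j, (if j == i then setT else B j) (x j)].
have mE : measurable E.
  by apply: (@measurable_box R I (fun j => if j == i then setT else B j)) => j; case: ifP.
have me : measurable_fun [set: R] (fun t : R => expR (s * t - s ^+ 2 / 2)%R).
  by apply: measurableT_comp => //; apply: measurable_funB.
pose gE := mrestr g mE.
have mi : measurable_fun [set: RI R I] ((fun x => x i) : RI R I -> measurableTypeR R).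
  exact: (@measurable_coord R I i).
pose kappa : {measure set (measurableTypeR R) -> \bar R} :=
  measure_function_pushforward__canonical__measure_function_Measure gE mi.
have kappaE A : measurable A -> kappa A = \int[normal_prob 0 1]_(t in A) c%:E.
  move=> mA; rewrite integral_cst// /kappa/= /pushforward /gE /mrestr.
  transitivity (g [set x | forall j, (if j == i then A else B j) (x j)]).
    congr (g _); apply/seteqP; split => x /=.
      by move=> [Ax Ex] j; have := Ex j; case: eqP => // ->.
    move=> ABx; split; first by have := ABx i; rewrite eqxx.
    by move=> j; have := ABx j; case: eqP.
  rewrite (gaussian_g (B := fun j => if j == i then A else B j)); last first.
    by move=> j; case: ifP.
  rewrite (bigD1 i)//= eqxx EFinM fineK ?fin_num_measure// muleC; congr (_%:E * _).
  by apply: eq_bigr => j /negbTE ->.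
pose h t : \bar R := if t \in B i then (expR (s * t - s ^+ 2 / 2))%:E else 0.
have h0 t : 0 <= h t by rewrite /h; case: ifP => // _; rewrite lee_fin expR_ge0.
have mh : measurable_fun [set: R] h.
  rewrite (_ : h = (EFin \o (fun t => expR (s * t - s ^+ 2 / 2)%R)) \_ (B i)).
    apply/(measurable_restrictT _ _).1 => //.
    by apply/measurable_EFinP; exact: measurable_funTS.
  by apply/funext => t; rewrite patchE.
transitivity (\int[gE]_x h (x i)).
  rewrite (@ge0_integral_density _ _ _ g gE (\1_E)).
  - rewrite [LHS]integral_mkcond; apply: eq_integral => x _.
    rewrite patchE /h indicE.
    have -> : (x \in [set x | forall j, B j (x j)]) = (x i \in B i) && (x \in E).
      apply/idP/andP; rewrite !inE /=.
        by move=> Bx; split => // j; case: eqP.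
      move=> [Bx Ex] j; have := Ex j; case: eqP => // -> _.
      exact: Bx.
    by case: (x i \in B i); case: (x \in E); rewrite /= ?mule1 ?mule0 ?mul0e.
  - exact: measurable_indic.
  - by move=> x.
  - by move=> A mA; rewrite integral_indic// setIC.
  - exact: measurableT_comp.
  - by move=> x.
rewrite -(@ge0_integral_pushforward _ _ _ _ _ _ mi gE setT h)//=.
rewrite (@ge0_integral_density _ _ _ (normal_prob 0 1) kappa (cst c))//=.
rewrite ge0_integralZr//.
by rewrite [in RHS]integral_mkcond; congr (_ * _); apply: eq_integral.
Qed.

(** The push-forward under translation and the tilted measure are compared on boxes, where only the
    [i]-th factor changes and [normal_prob_shift] matches it. *)
Let gaussian_shift1 i (s : R) F : measurable_fun [set: RI R I] F ->
  (forall x, 0 <= F x) ->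
  \int[g]_x F (translate (fun j => if j == i then s else 0%R) x) =
  \int[g]_x (F x * (tilt1 i s x)%:E).
Proof.
move=> mF F0; pose u : RI R I := fun j => if j == i then s else 0%R; rewrite -/u.
have e0 x : (0 <= tilt1 i s x)%R by exact: expR_ge0.
have [nu nuE] := density_measure g (@measurable_tilt1 i s) e0.
have mu_ := measurable_translate u.
rewrite -(@ge0_integral_density _ _ _ g nu (tilt1 i s))//.
rewrite -(@ge0_integral_pushforward _ _ _ _ _ _ mu_ g setT F)//=.
apply: eq_measure_integral => A mA _; apply: RI_measure_unique => //=.
  by rewrite /pushforward preimage_setT probability_setT ltry.
move=> B mB; rewrite [RHS]nuE (integral_box_tilt1 i s mB) -normal_prob_shift//.
have mBs j : measurable ((fun t : R => t + u j)%R @^-1` B j).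
  rewrite -[X in measurable X]setTI.
  have : measurable_fun [set: R] (fun t : R => (t + u j)%R) by exact: measurable_funD.
  by apply.
have := @gaussian_g (fun j => (fun t : R => t + u j)%R @^-1` B j) mBs.
rewrite /pushforward => ->.
rewrite (bigD1 i)//= EFinM fineK; last first.
  by apply: fin_num_measure; have := mBs i.
rewrite /u eqxx; congr (_ * _%:E).
apply: eq_bigr => j /negbTE ->; congr (fine (normal_prob _ _ _)).
by apply/seteqP; split => t /=; rewrite addr0.
Qed.

(** Coordinates are shifted one at a time; the tilts multiply because shifting the other coordinates
    leaves [tilt1 i] unchanged. *)
Lemma gaussian_shift u F : measurable_fun [set: RI R I] F ->
  (forall x, 0 <= F x) ->
  \int[g]_x F (translate u x) =
  \int[g]_x (F x * (expR (\sum_i (u i * x i - u i ^+ 2 / 2)))%:E).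
Proof.
(* [uu r] moves only the coordinates listed in [r], and [e r] is the matching tilt; the induction is
   on [r]. *)
pose uu (r : seq I) : RI R I := fun j => if j \in r then u j else 0%R.
pose e (r : seq I) x := expR (\sum_(i <- r) (u i * x i - u i ^+ 2 / 2))%R.
have me r : measurable_fun [set: RI R I] (e r).
  apply: measurableT_comp => //; apply: measurable_sum => i.
  by apply: measurable_funB => //; apply: measurable_funM => //; exact: (@measurable_coord R I).
suff H r : uniq r -> forall F, measurable_fun [set: RI R I] F ->
    (forall x, 0 <= F x) ->
    \int[g]_x F (translate (uu r) x) = \int[g]_x (F x * (e r x)%:E).
  move=> mF F0; have := H _ (index_enum_uniq I) F mF F0.
  by rewrite (_ : uu _ = u)//; apply/funext => i; rewrite /uu mem_index_enum.
elim: r => [_ {}F mF F0|i r IH /= /andP[ir ur] {}F mF F0].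
  apply: eq_integral => x _; rewrite /e big_nil expR0 mule1; congr F.
  by apply/funext => i; rewrite /translate /uu addr0.
transitivity (\int[g]_x (F \o translate (uu r))
    (translate (fun j => if j == i then u i else 0%R) x)).
  apply: eq_integral => x _ /=; congr F; apply/funext => j.
  rewrite /translate /uu inE -addrA; congr (_ + _)%R.
  by have [->|] := eqVneq j i; rewrite ?(negbTE ir) ?addr0 ?add0r.
rewrite gaussian_shift1; last 2 first.
- by apply: measurableT_comp => //; exact: measurable_translate.
- by move=> x /=.
transitivity (\int[g]_x (fun y => F y * (tilt1 i (u i) y)%:E) (translate (uu r) x)).
  apply: eq_integral => x _ /=.
  have -> // : tilt1 i (u i) (translate (uu r) x) = tilt1 i (u i) x.
  by rewrite /tilt1 /translate /uu (negbTE ir) addr0.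
rewrite (IH ur (fun y => F y * (tilt1 i (u i) y)%:E)).
- apply: eq_integral => x _; rewrite -muleA -EFinM; congr (_ * _%:E).
  by rewrite /tilt1 /e big_cons [in RHS]expRD.
- by apply: emeasurable_funM => //; exact/measurable_EFinP.
- by move=> x; rewrite mule_ge0// lee_fin expR_ge0.
Qed.

End gaussian_shift.

(** * A reflection with a prescribed row *)

Section householder.
Context (R : realType) (n : nat) (i0 : 'I_n) (w : 'I_n -> R).

Let e0 : 'I_n -> R := fun i => (i == i0)%:R.

(* The Householder reflection exchanging the unit vectors [w] and [e0]. *)
Definition householder : 'M[R]_n :=
  \matrix_(i, j) ((i == j)%:R - (w i - e0 i) * (w j - e0 j) / (1 - w i0)).

Hypothesis w1 : \sum_i w i ^+ 2 = 1.
Hypothesis wi0 : w i0 != 1.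

Let sub_neq0 : 1 - w i0 != 0. Proof. by rewrite subr_eq0 eq_sym. Qed.

Let sum_delta (f : 'I_n -> R) i : \sum_j (i == j)%:R * f j = f i.
Proof.
rewrite (bigD1 i)//= eqxx mul1r big1 ?addr0// => j ji.
by rewrite eq_sym (negbTE ji) mul0r.
Qed.

(** The vector [w - e0] has squared norm 2 (1 - [w i0]), so the divisor is that of a reflection and
    the linear terms cancel the quadratic one. *)
Lemma householder_orthogonal : householder *m householder^T = 1%:M.
Proof.
apply/matrixP => i j; rewrite !mxE.
have u2 : \sum_k (w k - e0 k) ^+ 2 = 2 * (1 - w i0).
  transitivity (\sum_k (w k ^+ 2 + (i0 == k)%:R * (1 - w k *+ 2))).
    apply: eq_bigr => k _; rewrite /e0 eq_sym.
    by case: eqP => _ /=; ring.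
  by rewrite big_split/= w1 sum_delta; ring.
set c := (1 - w i0)^-1.
transitivity (\sum_k ((i == k)%:R * (j == k)%:R
   - (i == k)%:R * ((w k - e0 k) * (w j - e0 j) * c)
   - (j == k)%:R * ((w k - e0 k) * (w i - e0 i) * c)
   + (w i - e0 i) * (w j - e0 j) * c ^+ 2 * (w k - e0 k) ^+ 2)).
  by apply: eq_bigr => k _; rewrite !mxE /c; ring.
rewrite !big_split/= !sumrN !sum_delta -mulr_sumr u2 eq_sym /c.
by move: sub_neq0; move: (i == j)%:R => b h; field.
Qed.

(** This makes coordinate [i0] of the reflected vector equal to its inner product with [w]. *)
Lemma householder_row j : householder i0 j = w j.
Proof.
rewrite mxE /e0 eqxx eq_sym /=.
by move: sub_neq0; move: (j == i0)%:R => b h; field.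
Qed.

End householder.

(** * Moments of a coordinate under the uniform law on the sphere *)

Section sphere_moments.
Context (R : realType) (n : nat) (mu : probability (vec R n) R).
Hypothesis mu_unif : uniform_on_sphere mu.
Local Notation S := (@unit_sphere R n).

Lemma measurable_unit_sphere : measurable S.
Proof.
have mf : measurable_fun [set: vec R n] (fun x : vec R n => \sum_(i < n) x i ^+ 2).
  apply: measurable_sum => i; apply: measurable_funX.
  exact: (@measurable_coord R 'I_n).
have := mf measurableT [set 1] (measurable_set1 1); rewrite setTI.
by congr (measurable _).
Qed.

Let mS := measurable_unit_sphere.

Let mu_S : mu S = 1%E := mu_unif.1.

Lemma unit_sphere_coord_le1 x i : S x -> `|x i| <= 1.
Proof.
move=> Sx; rewrite -(@ler_pXn2r _ 2) ?nnegrE// expr1n real_normK ?num_real//.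
rewrite -[leRHS]Sx (bigD1 i)//= lerDl sumr_ge0// => j _.
exact: sqr_ge0.
Qed.

Lemma sphere_integrable (f : vec R n -> R) M :
  measurable_fun [set: vec R n] f -> (forall x, S x -> `|f x| <= M) ->
  mu.-integrable S (EFin \o f).
Proof.
move=> mf fM; apply: measurable_bounded_integrable => //.
- by rewrite (le_lt_trans (probability_le1 _ mS))// ltry.
- exact: measurable_funTS.
- exists M; split; first exact: num_real.
  by move=> y My x Sx /=; apply: le_trans (ltW My); exact: fM.
Qed.

Lemma measurable_mx_act (O : 'M[R]_n) : measurable_fun [set: vec R n] (mx_act O).
Proof.
apply: measurable_RI => i; apply: measurable_sum => j.
by apply: measurable_funM => //; exact: (@measurable_coord R 'I_n).
Qed.

Lemma mx_act_sphere (O : 'M[R]_n) : O *m O^T = 1%:M -> mx_act O @^-1` S = S.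
Proof.
move=> /mulmx1C OO; apply/seteqP.
suff E x : \sum_i mx_act O x i ^+ 2 = \sum_i x i ^+ 2.
  by split => x; rewrite /unit_sphere /= E.
transitivity (\sum_i \sum_j \sum_k (x j * x k) * (O i j * O i k)).
  apply: eq_bigr => i _; rewrite expr2 /mx_act mulr_suml; apply: eq_bigr => j _.
  rewrite mulr_sumr; apply: eq_bigr => k _; ring.
rewrite exchange_big/=; apply: eq_bigr => j _; rewrite exchange_big/=.
rewrite (bigD1 j)//= [X in _ + X]big1 => [|k kj].
  rewrite addr0 -mulr_sumr; have /matrixP/(_ j j) := OO.
  rewrite !mxE eqxx; under eq_bigr do rewrite mxE.
  by move=> ->; rewrite mulr1 expr2.
rewrite -mulr_sumr; have /matrixP/(_ j k) := OO.
rewrite !mxE eq_sym (negbTE kj); under eq_bigr do rewrite mxE.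
by move=> ->; rewrite mulr0.
Qed.

Lemma sphere_integral_invariant (O : 'M[R]_n) (f : vec R n -> \bar R) :
  O *m O^T = 1%:M -> measurable_fun [set: vec R n] f -> (forall x, 0 <= f x)%E ->
  (\int[mu]_(x in S) f (mx_act O x) = \int[mu]_(x in S) f x)%E.
Proof.
move=> OO mf f0.
have mO := measurable_mx_act O.
rewrite -{1}(mx_act_sphere OO) -[LHS](@ge0_integral_pushforward _ _ _ _ _ _ mO)//.
- by apply: eq_measure_integral => A mA _; exact: mu_unif.2.
- exact: measurable_funTS.
Qed.

(** Invariance under the reflection whose row [i0] is [w] turns one linear functional into the
    other. *)
Lemma sphere_integral_dot (i0 : 'I_n) (w : 'I_n -> R) (f : R -> \bar R) :
  \sum_i w i ^+ 2 = 1 -> measurable_fun [set: R] f -> (forall x, 0 <= f x)%E ->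
  (\int[mu]_(x in S) f (\sum_i w i * x i)%R = \int[mu]_(x in S) f (x i0))%E.
Proof.
move=> w1 mf f0.
have mi i : measurable_fun [set: vec R n] (fun x : vec R n => x i).
  exact: (@measurable_coord R 'I_n).
(* When [w i0] is 1 the reflection would divide by zero, but a unit vector with this entry is the
   basis vector itself. *)
have [wi|wi] := eqVneq (w i0) 1.
  have w0 j : j != i0 -> w j = 0.
    move=> ji; apply/eqP; rewrite -sqrf_eq0; apply/eqP; apply: le_anti.
    rewrite sqr_ge0 andbT; have := w1.
    rewrite (bigD1 i0)//= wi expr1n (bigD1 j)//=.
    have : 0 <= \sum_(k | (k != i0) && (k != j)) w k ^+ 2.
      by apply: sumr_ge0 => k _; exact: sqr_ge0.
    lra.
  apply: eq_integral => x _; congr f.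
  rewrite (bigD1 i0)//= wi mul1r big1 ?addr0// => j ji.
  by rewrite w0// mul0r.
rewrite -[RHS](@sphere_integral_invariant (householder i0 w) (fun x => f (x i0))).
- apply: eq_integral => x _; congr f; apply: eq_bigr => j _.
  by rewrite householder_row.
- exact: householder_orthogonal.
- exact: measurableT_comp.
- by [].
Qed.

Let mcoord (i : 'I_n) : measurable_fun [set: vec R n] (fun x : vec R n => x i).
Proof. exact: (@measurable_coord R 'I_n). Qed.

Let sphere_integrable_monomial i j a b :
  mu.-integrable S (EFin \o (fun x : vec R n => x i ^+ a * x j ^+ b)).
Proof.
apply: (@sphere_integrable _ 1).
  by apply: measurable_funM; apply: measurable_funX.
move=> x Sx; rewrite normrM !normrX.
by rewrite mulr_ile1 ?exprn_ge0 ?exprn_ile1 ?unit_sphere_coord_le1.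
Qed.

Lemma Rintegral_sum d (T : measurableType d) (nu : {measure set T -> \bar R})
    (D : set T) I (s : seq I) (f : I -> T -> R) : measurable D ->
  (forall i, nu.-integrable D (EFin \o f i)) ->
  \int[nu]_(x in D) (\sum_(i <- s) f i x) = \sum_(i <- s) \int[nu]_(x in D) f i x.
Proof.
move=> mD fi; elim: s => [|i s IH].
  rewrite big_nil; under eq_Rintegral do rewrite big_nil.
  by rewrite Rintegral_cst// mul0r.
rewrite big_cons -IH -RintegralD//.
  by apply: eq_Rintegral => x _; rewrite big_cons.
rewrite (_ : EFin \o _ = (fun x => \sum_(j <- s) (f j x)%:E)%E).
  by apply: integrable_sum => // j _; exact: fi.
by apply/funext => x /=; rewrite sumEFin.
Qed.

(* The law of [x i + t x j] is that of [(1 + t^2)^(1/2) x i]; this compares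
   the coefficients of [t^2] in the moments of order [2 m + 2]. *)
Lemma sphere_cross_moment i j m : i != j ->
  (2 * m + 1)%:R * \int[mu]_(x in S) (x i ^+ (2 * m) * x j ^+ 2) =
  \int[mu]_(x in S) x i ^+ (2 * m.+1).
Proof.
move=> ij; set c := (RHS).
pose N := (2 * m.+1)%N.
pose a k := \int[mu]_(x in S) (x i ^+ (N - k) * x j ^+ k).
(* Binomial expansion gives the left side, rescaling to a unit direction the right side; both are
   polynomials in [t]. *)
have H t : \sum_(k < N.+1) 'C(N, k)%:R * a k * t ^+ k = (1 + t ^+ 2) ^+ m.+1 * c.
  have t0 : 0 < 1 + t ^+ 2 by rewrite ltr_pwDl// sqr_ge0.
  transitivity (\int[mu]_(x in S) (x i + t * x j) ^+ N).
    rewrite [RHS](_ : _ = \int[mu]_(x in S) (\sum_(k < N.+1)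
        ('C(N, k)%:R * t ^+ k * (x i ^+ (N - k) * x j ^+ k)))); last first.
      apply: eq_Rintegral => x _; rewrite exprDn; apply: eq_bigr => k _.
      by rewrite exprMn -mulr_natr; ring.
    rewrite Rintegral_sum//.
      by apply: eq_bigr => k _; rewrite RintegralZl// mulrAC.
    move=> k; rewrite (_ : EFin \o _ =
        (fun x : vec R n => ('C(N, k)%:R * t ^+ k)%:E * (x i ^+ (N - k) * x j ^+ k)%:E)%E).
      by apply: integrableZl => //; exact: sphere_integrable_monomial.
    by apply/funext => x /=; rewrite EFinM.
  (* The unit vector in the direction e_i + t e_j. *)
  pose w k : R := ((k == i)%:R + t * (k == j)%:R) / Num.sqrt (1 + t ^+ 2).
  have dotw (x : 'I_n -> R) : \sum_k w k * x k = (x i + t * x j) / Num.sqrt (1 + t ^+ 2).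
    rewrite (bigD1 i)//= (bigD1 j)/= 1?eq_sym// big1 => [|k /andP[ki kj]].
      by rewrite /w !eqxx (negbTE ij) eq_sym (negbTE ij) /=; ring.
    by rewrite /w (negbTE ki) (negbTE kj) /=; ring.
  have w1 : \sum_k w k ^+ 2 = 1.
    under eq_bigr do rewrite expr2.
    rewrite dotw /w !eqxx (negbTE ij) eq_sym (negbTE ij) /= mulr0 mulr1 addr0 add0r.
    rewrite !mulrA -mulrDl -expr2 -mulrA -invfM -expr2 sqr_sqrtr ?ltW//.
    by rewrite divff ?gt_eqF.
  have mN : measurable_fun [set: R] (fun y : R => (y ^+ N)%:E).
    by apply/measurable_EFinP; exact: measurable_funX.
  have N0 (y : R) : (0 <= (y ^+ N)%:E)%E.
    by rewrite lee_fin /N exprM exprn_ge0// sqr_ge0.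
  rewrite /c /Rintegral -/N -(sphere_integral_dot i w1 mN N0).
  rewrite -[LHS]/(\int[mu]_(x in S) _) -[X in _ * X]/(\int[mu]_(x in S) _).
  rewrite -RintegralZl//.
    apply: eq_Rintegral => x _; rewrite dotw expr_div_n /N [in X in _ / X]exprM.
    by rewrite sqr_sqrtr ?ltW// mulrCA divff ?mulr1// expf_neq0// gt_eqF.
  apply: (@sphere_integrable _ (n%:R ^+ N)).
    apply: measurable_funX; apply: measurable_sum => k.
    exact: measurable_funM.
  move=> x Sx; rewrite normrX lerXn2r ?nnegrE// (le_trans (ler_norm_sum _ _ _))//.
  rewrite -[n in leRHS]card_ord -sum1_card natr_sum; apply: ler_sum => k _.
  by rewrite normrM mulr_ile1 ?(@unit_sphere_coord_le1 w) ?unit_sphere_coord_le1.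
(* The two polynomials agree at every natural number, which is more roots than a nonzero difference
   can have, so their coefficients agree. *)
pose p := \poly_(k < N.+1) ('C(N, k)%:R * a k).
pose q := (1 + 'X^2) ^+ m.+1 * c%:P.
have pq : p = q.
  apply/eqP; rewrite -subr_eq0; apply/negP => /negP pq0.
  have := @max_poly_roots _ (p - q) [seq k%:R | k <- iota 0 (size (p - q))] pq0.
  rewrite size_map size_iota ltnn => h; suff : false by []; apply: h.
    apply/allP => _ /mapP[k _ ->]; rewrite /root !hornerE.
    by rewrite /p horner_poly H subrr.
  rewrite map_inj_uniq ?iota_uniq//.
  by move=> k l /eqP; rewrite eqr_nat => /eqP.
have := congr1 (fun r : {poly R} => r`_2) pq.
rewrite /p coef_poly /q coefMC exprDn coef_sum (bigD1 (inord 1))//= inordK//.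
rewrite big1 ?addr0 => [|k k1]; last first.
  rewrite expr1n mul1r -exprM coefMn coefXn; case: eqP => [k2|]; last by rewrite mul0rn.
  case/eqP: k1; apply: val_inj; rewrite /= inordK//.
  by move/eqP: k2; rewrite -[X in X == _]/(2 * 1)%N eqn_mul2l /= => /eqP.
rewrite expr1n mul1r expr1 coefMn coefXn eqxx bin1.
have -> : (2 < N.+1)%N by rewrite ltnS /N mulnS leq_addr.
(* The coefficient of X^2 is (m + 1) (2 m + 1) times the mixed moment on the left and (m + 1) [c] on
   the right; m + 1 cancels. *)
have -> : 'C(N, 2) = (m.+1 * (2 * m + 1))%N.
  by rewrite bin2 /N -mulnA mul2n doubleK; congr (_ * _)%N; lia.
have -> : a 2%N = \int[mu]_(x in S) (x i ^+ (2 * m) * x j ^+ 2).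
  by rewrite /a (_ : N - 2 = 2 * m)%N //; rewrite /N; lia.
rewrite natrM -mulrA /= => /mulfI; apply; by rewrite pnatr_eq0.
Qed.

(** Insert 1 = sum of x_j^2. Each of the n - 1 indices j other than [i] contributes [c] / (2 m + 1)
    by the cross moment, and j = [i] contributes [c]. *)
Lemma sphere_moment_rec i m :
  (n + 2 * m)%:R * \int[mu]_(x in S) x i ^+ (2 * m.+1) =
  (2 * m + 1)%:R * \int[mu]_(x in S) x i ^+ (2 * m).
Proof.
set c := \int[mu]_(x in S) x i ^+ (2 * m.+1).
have -> : \int[mu]_(x in S) x i ^+ (2 * m) =
    \sum_j \int[mu]_(x in S) (x i ^+ (2 * m) * x j ^+ 2).
  rewrite -Rintegral_sum//.
  apply: eq_Rintegral => x; rewrite inE => Sx.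
  by rewrite -mulr_sumr [X in _ * X](_ : _ = 1) ?mulr1.
rewrite mulr_sumr (bigD1 i)//=.
rewrite (eq_bigr (fun=> c)) => [|j ji]; last by rewrite sphere_cross_moment// eq_sym.
have -> : \int[mu]_(x in S) (x i ^+ (2 * m) * x i ^+ 2) = c.
  by apply: eq_Rintegral => x _; rewrite -exprD mulnS addnC.
rewrite sumr_const cardC1 card_ord -[c *+ _]mulr_natl -mulrDl -natrD.
by congr (_%:R * _); have := ltn_ord i; lia.
Qed.

Lemma sphere_moment i l : \int[mu]_(x in S) x i ^+ (2 * l) =
  \prod_(k < l) ((2 * k + 1)%:R / (n + 2 * k)%:R).
Proof.
elim: l => [|l IH].
  rewrite big_ord0; under eq_Rintegral do rewrite expr0.
  by rewrite Rintegral_cst// [X in fine X](mu_S : _ = 1%E) mulr1.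
rewrite big_ord_recr/= -IH mulrA [X in X / _]mulrC -sphere_moment_rec.
by rewrite [X in X / _]mulrC mulfK// pnatr_eq0 -lt0n ltn_addr//  (leq_ltn_trans _ (ltn_ord i)).
Qed.

(** The terms are nonnegative, so sum and integral are exchanged and only real partial sums need a
    bound, even if the series is infinite at some points. *)
Lemma sphere_series_le i (a : nat -> R) (C : R) : (forall k, 0 <= a k) ->
  (forall L, \sum_(k < L) a k * \prod_(j < k) ((2 * j + 1)%:R / (n + 2 * j)%:R) <= C) ->
  (\int[mu]_(x in S) (\sum_(0 <= k <oo) (a k * x i ^+ (2 * k))%:E) <= C%:E)%E.
Proof.
move=> a0 aC.
have x0 (x : vec R n) k : 0 <= a k * x i ^+ (2 * k).
  by rewrite mulr_ge0// exprM exprn_ge0// sqr_ge0.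
rewrite integral_nneseries//; last 2 first.
- move=> k; apply/measurable_EFinP; apply: measurable_funTS; apply: measurable_funM => //.
  exact: measurable_funX.
- by move=> k x _; rewrite lee_fin.
apply: lime_le.
  by apply: is_cvg_nneseries => k _ _; apply: integral_ge0 => x _; rewrite lee_fin.
apply: nearW => L; rewrite (eq_bigr (fun k : nat =>
    (a k * \prod_(j < k) ((2 * j + 1)%:R / (n + 2 * j)%:R))%:E)).
  by rewrite sumEFin lee_fin big_mkord.
move=> k _; rewrite -(sphere_moment i) EFinM.
under eq_integral do rewrite EFinM.
have int_k : mu.-integrable S (EFin \o (fun x : vec R n => x i ^+ (2 * k))).
  have := sphere_integrable_monomial i i (2 * k) 0.
  by congr (_.-integrable _ _); apply/funext => x /=; rewrite mulr1.
by rewrite integralZl// /Rintegral fineK//; exact: integrable_fin_num.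
Qed.

End sphere_moments.

(** * Exponential and negative binomial series *)

Section power_series.
Context (R : realType).

Lemma nneseries_EFin_cvg (u : nat -> R) (l : R) : series u @ \oo --> l ->
  (\sum_(0 <= k <oo) (u k)%:E)%E = l%:E.
Proof.
move=> ul; rewrite -(cvg_lim _ ul)// -EFin_lim; last by apply/cvg_ex; exists l.
by apply/congr_lim/funext => n /=; rewrite /series/= sumEFin.
Qed.

Lemma nneseries_expR (x : R) :
  (\sum_(0 <= k <oo) (x ^+ k / k`!%:R)%:E)%E = (expR x)%:E.
Proof.
have cx : cvgn (series (exp_coeff x)) by exact: is_cvg_series_exp_coeff.
rewrite (@nneseries_EFin_cvg _ (limn (series (exp_coeff x)))); last exact: cx.
by [].
Qed.

Let b N k (x : R) := 'C(N + k, N)%:R * x ^+ k.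

Let b_ge0 N k (x : R) : 0 <= x -> 0 <= b N k x.
Proof. by move=> x0; rewrite mulr_ge0// exprn_ge0. Qed.

(** Pascal's rule: multiplying by 1 - x lowers the order by one, up to a boundary term. *)
Let negbin_partial N L (x : R) : series (b N ^~ x) L =
  (1 - x) * series (b N.+1 ^~ x) L + 'C(N + L, N.+1)%:R * x ^+ L.
Proof.
elim: L => [|L IH].
  by rewrite /series /= !big_geq// addn0 bin_small// mulr0 mul0r addr0.
rewrite !seriesSr IH /b addSn addnS binS natrD exprS.
ring.
Qed.

(** Induction on [N]. Partial sums of order N + 1 are bounded by those of order N divided by 1 - x,
    hence converge; their terms then tend to 0 and dominate the boundary term. *)
Lemma cvg_negative_binomial N (x : R) : 0 <= x < 1 ->
  series (fun k => 'C(N + k, N)%:R * x ^+ k) @ \oo --> (1 - x) ^- N.+1.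
Proof.
move=> /andP[x0 x1]; have x1' : 0 < 1 - x by rewrite subr_gt0.
elim: N => [|N IH].
  have := @cvg_geometric_series R 1 x; rewrite ger0_norm// => /(_ x1).
  rewrite mul1r expr1; apply: cvg_trans; apply: near_eq_cvg; apply: nearW => L.
  by apply: eq_bigr => k _ /=; rewrite bin0 /geometric/=.
have nd M : nondecreasing_seq (series (b M ^~ x)).
  by apply: nondecreasing_series => k _ _; exact: b_ge0.
have cN : cvgn (series (b N ^~ x)) by apply/cvg_ex; eexists; exact: IH.
have cS : cvgn (series (b N.+1 ^~ x)).
  apply: nondecreasing_is_cvgn => //.
  exists ((1 - x) ^- N.+1 / (1 - x)) => _ [L _ <-].
  rewrite ler_pdivlMr// mulrC; apply: (@le_trans _ _ (series (b N ^~ x) L)).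
    rewrite (negbin_partial N) lerDl mulr_ge0// ?exprn_ge0//.
  by rewrite -(cvg_lim (@Rhausdorff R) IH); exact: nondecreasing_cvgn_le.
have r0 : 'C(N + L, N.+1)%:R * x ^+ L @[L --> \oo] --> (0 : R).
  apply: (@squeeze_cvgr _ _ _ _ (fun=> 0) (b N.+1 ^~ x)).
  - apply: nearW => L; rewrite mulr_ge0 ?exprn_ge0//= ler_wpM2r ?exprn_ge0//.
    by rewrite ler_nat addSn binS leq_addr.
  - exact: cvg_cst.
  - exact: cvg_series_cvg_0.
have -> : (1 - x) ^- N.+2 = (1 - x)^-1 * ((1 - x) ^- N.+1 - 0).
  by rewrite subr0 exprS invfM.
have : (1 - x)^-1 * (series (b N ^~ x) L - 'C(N + L, N.+1)%:R * x ^+ L)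
    @[L --> \oo] --> (1 - x)^-1 * ((1 - x) ^- N.+1 - 0).
  by apply: cvgM; [exact: cvg_cst|exact: cvgB].
apply: cvg_trans; apply: near_eq_cvg; apply: nearW => L /=.
by rewrite (negbin_partial N) addrK mulKf// gt_eqF.
Qed.

(* At [x = 1] the hypothesis on [y] is void and the series is infinite. *)
Lemma le_negative_binomial N (x y : R) : 0 <= x <= 1 -> y * (1 - x) ^+ N.+1 <= 1 ->
  (y%:E <= \sum_(0 <= k <oo) ('C(N + k, N)%:R * x ^+ k)%:E)%E.
Proof.
move=> /andP[x0 x1] yx; have [x1'|x1'] := ltP x 1.
  rewrite (nneseries_EFin_cvg (@cvg_negative_binomial N x _)) ?x0//.
  by rewrite lee_fin -[leRHS]mul1r ler_pdivlMr// exprn_gt0// subr_gt0.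
have {x1 x1' yx} -> : x = 1 by apply/eqP; rewrite eq_le x1.
(* At x = 1 every term is at least 1, so the first [L.+1] terms already exceed [y]. *)
pose L := Num.truncn `|y|.
apply: (@le_trans _ _ (L.+1%:R%:E)).
  by rewrite lee_fin (le_trans (ler_norm _))// ltW// truncnS_gt.
apply: le_trans (nneseries_lim_ge L.+1 _); last first.
  by move=> k _ _; rewrite lee_fin b_ge0.
rewrite sumEFin lee_fin big_mkord -[X in X%:R]card_ord -sum1_card natr_sum.
apply: ler_sum => k _; rewrite expr1n mulr1 ler_nat bin_gt0.
exact: leq_addr.
Qed.

End power_series.

(** * The threshold and elementary estimates *)

Section threshold.
Context (R : realType).

Let threshold_set k : set R :=
  [set Num.sqrt (- (q ^+ k)^-1 * ln (1 - q ^+ 2)) | q in `]0, 1[%classic].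

Let has_lbound_threshold k : has_lbound (threshold_set k).
Proof. by exists 0 => _ [q _ <-]. Qed.

Let half_itv : `]0, 1[%classic (2^-1 : R).
Proof. by rewrite /= in_itv/=; apply/andP; split; lra. Qed.

Lemma sqr_in01 (q : R) : 0 < q < 1 -> 0 < q ^+ 2 < 1.
Proof. by move=> /andP[q0 q1]; rewrite exprn_gt0//= exprn_ilt1// ltW. Qed.

(** This bound and the next are ln(1 + y) <= y, at y = -x here and at y = x / (1 - x) there. *)
Lemma ln_1Bx_ge (x : R) : x < 1 -> x <= - ln (1 - x).
Proof. by move=> x1; have := @le_ln1Dx R (- x); rewrite ltrN2 => /(_ x1); rewrite lerNr. Qed.

Lemma ln_1Bx_le (x : R) : x < 1 -> - ln (1 - x) <= x / (1 - x).
Proof.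
move=> x1; have x0 : 0 < 1 - x by rewrite subr_gt0.
have e : (1 - x)^-1 = 1 + x / (1 - x) by field; rewrite gt_eqF.
rewrite -lnV ?posrE// [X in ln X]e; apply: le_ln1Dx.
by rewrite -(ltrD2l 1) subrr -e invr_gt0.
Qed.

Lemma beta2nd_sqr_le k (q : R) : 0 < q < 1 ->
  beta2nd R k ^+ 2 * q ^+ k <= - ln (1 - q ^+ 2).
Proof.
move=> q01; have [q0 q1] := andP q01; have [q20 q21] := andP (sqr_in01 q01).
have l0 : 0 <= - ln (1 - q ^+ 2) by rewrite (le_trans (ltW q20))// ln_1Bx_ge.
rewrite -ler_pdivlMr ?exprn_gt0//.
have e : - ln (1 - q ^+ 2) / q ^+ k = - (q ^+ k)^-1 * ln (1 - q ^+ 2) by ring.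
have b0 : 0 <= beta2nd R k.
  apply: lb_le_inf; first by eexists; exists 2^-1; [exact: half_itv|].
  by move=> _ [r _ <-].
rewrite e -[leRHS]sqr_sqrtr; last by rewrite -e divr_ge0// exprn_ge0// ltW.
rewrite ler_pXn2r ?nnegrE//.
by apply: ge_inf; [exact: has_lbound_threshold|exists q => //=; rewrite in_itv].
Qed.

(** The bound -ln(1 - x) >= x gives at least 1 at every q; the upper bound x / (1 - x) shows that
    small q come arbitrarily close to 1. *)
Lemma beta2nd2 : beta2nd R 2 = 1.
Proof.
apply/eqP; rewrite eq_le; apply/andP; split; last first.
  apply: lb_le_inf; first by eexists; exists 2^-1; [exact: half_itv|].
  move=> _ [q + <-]; rewrite /= in_itv/= => q01.
  have [q20 q21] := andP (sqr_in01 q01).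
  rewrite -[leLHS]sqrtr1 ler_wsqrtr// mulNr -mulrN mulrC ler_pdivlMr// mul1r.
  exact: ln_1Bx_ge.
rewrite leNgt; apply/negP => I1; set I := beta2nd R 2 in I1.
have I2 : 1 < I ^+ 2 by rewrite exprn_egt1.
have I2V : 0 < (I ^+ 2)^-1 < 1.
  have I20 : 0 < I ^+ 2 by exact: lt_trans I2.
  by rewrite invr_gt0 invf_lt1// I20 I2.
(* With q^2 = [x] the threshold bound gives I^2 (1 - x) <= 1, whereas this [x] lies below 1 -
   I^-2. *)
pose x := (1 - (I ^+ 2)^-1) / 2.
have x01 : 0 < x < 1 by rewrite /x; apply/andP; split; lra.
have [x0 x1] := andP x01.
have q01 : 0 < Num.sqrt x < 1.
  by rewrite sqrtr_gt0 x0/= -[ltRHS]sqrtr1 ltr_sqrt.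
have := beta2nd_sqr_le 2 q01; rewrite sqr_sqrtr; last exact: ltW.
move=> /le_trans/(_ (ln_1Bx_le x1)); rewrite -/I.
rewrite ler_pdivlMr ?subr_gt0// mulrAC -[leRHS]mul1r ler_pM2r//.
rewrite leNgt => /negP; apply.
rewrite -ltr_pdivrMl ?(lt_trans _ I2)// mulr1 /x; lra.
Qed.

(** Scaling [beta2nd_sqr_le] by the squared ratio of [beta] to the threshold turns the strict
    inequality into a slack [delta] uniform in q. *)
Lemma beta2nd_gap k (beta : R) : 0 <= beta -> beta < beta2nd R k ->
  exists2 delta, 0 < delta <= 1 & forall q, 0 < q < 1 ->
    beta ^+ 2 * q ^+ k <= (1 - delta) * - ln (1 - q ^+ 2).
Proof.
move=> b0 bb; have B0 : 0 < beta2nd R k by exact: le_lt_trans bb.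
exists (1 - (beta / beta2nd R k) ^+ 2).
  rewrite subr_gt0 exprn_ilt1 ?divr_ge0 ?(ltW B0)//=; last first.
    by rewrite ltr_pdivrMr// mul1r.
  by rewrite gerBl sqr_ge0.
move=> q q01; rewrite opprB addrC subrK.
apply: le_trans (ler_wpM2l (sqr_ge0 _) (beta2nd_sqr_le k q01)).
by rewrite mulrA -exprMn divfK// gt_eqF.
Qed.

(** The bound exp x >= 1 + x^2 / 2 beats the linear factor once n e c^2 >= 2. *)
Lemma mulr_expRN_cvg (c e : R) : 0 < c -> 0 < e ->
  exists n0, forall n, (n0 <= n)%N -> n%:R * expR (- (n%:R * c)) <= e.
Proof.
move=> c0 e0; exists (Num.truncn (2 / c ^+ 2 / e)).+1 => n n0n.
have n0 : 0 < n%:R :> R by rewrite ltr0n (leq_trans _ n0n).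
have H : 2 / c ^+ 2 / e <= n%:R.
  by rewrite ltW// (lt_le_trans (truncnS_gt _))// ler_nat.
rewrite expRN ler_pdivrMr ?expR_gt0//.
have {}H : 2 <= n%:R * e * c ^+ 2 by rewrite -!ler_pdivrMr ?exprn_gt0// mulrAC.
have E : 1 + (n%:R * c) ^+ 2 / 2 <= expR (n%:R * c) :=
  @expR_ge1Dxn R (n%:R * c) 1 (mulr_ge0 (ltW n0) (ltW c0)).
apply: le_trans (ler_wpM2l (ltW e0) E).
rewrite (_ : e * _ = e + n%:R * (n%:R * e * c ^+ 2 / 2)); last by field.
apply: ler_wpDl; first exact: ltW.
by rewrite ler_peMr ?(ltW n0)//; lra.
Qed.

End threshold.

(** * Exponential moments of the overlap *)

Section overlap.
Context (R : realType) (n : nat) (mu : probability (vec R n) R).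
Hypothesis mu_unif : uniform_on_sphere mu.
Local Notation S := (@unit_sphere R n).
Variable i : 'I_n.

Let n0 : (0 < n)%N := leq_ltn_trans (leq0n i) (ltn_ord i).

Let nk0 k : 0 < (n + 2 * k)%:R :> R.
Proof. by rewrite ltr0n ltn_addr. Qed.

(** Term k of the expanded exponential has expectation at most c^k: passing to k + 1 multiplies it
    by c n (2 k + 1) / (2 (k + 1) (n + 2 k)) <= c. A geometric series remains. *)
Lemma exp_sqr_moment_le (c : R) : 0 <= c < 1 ->
  (\int[mu]_(x in S) (expR (n%:R * c / 2 * x i ^+ 2))%:E <= (1 - c)^-1%:E)%E.
Proof.
move=> /andP[c0 c1]; have c1' : 0 < 1 - c by rewrite subr_gt0.
pose a k : R := (n%:R * c / 2) ^+ k / k`!%:R.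
have a0 k : 0 <= a k.
  by rewrite divr_ge0// exprn_ge0// divr_ge0// mulr_ge0.
rewrite (eq_integral (fun x : vec R n =>
    (\sum_(0 <= k <oo) (a k * x i ^+ (2 * k))%:E)%E)); last first.
  move=> x _; rewrite -nneseries_expR; apply: eq_eseriesr => k _.
  by rewrite /a exprMn exprM mulrAC.
apply: sphere_series_le => // L.
rewrite -[leRHS]mul1r ler_pdivlMr//.
apply: (@le_trans _ _ ((\sum_(k < L) c ^+ k) * (1 - c))).
  apply: ler_wpM2r; first exact: ltW.
  apply: ler_sum => -[k _] _ /=; elim: k => [|k IH].
    by rewrite /a big_ord0 !expr0 fact0 divr1 mulr1.
  rewrite exprSr; apply: le_trans (ler_wpM2r c0 IH).
  rewrite big_ord_recr/=.
  have -> : a k.+1 = a k * (n%:R * c / (2 * k.+1%:R)).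
    rewrite /a factS natrM exprSr; field.
    by rewrite pnatr_eq0 -lt0n fact_gt0 andbT addrC natr1 pnatr_eq0.
  rewrite mulrACA; apply: ler_wpM2l.
    by apply: mulr_ge0 => //; apply: prodr_ge0 => j _; exact: divr_ge0.
  rewrite mulf_div ler_pdivrMr ?mulr_gt0//.
  rewrite -mulrA mulrCA; apply: ler_wpM2l => //.
  by rewrite -!natrM ler_nat; nia.
rewrite mulrC -opprB mulNr -subrX1 opprB.
by rewrite gerBl exprn_ge0.
Qed.
(** The expectation of term k is at most [r k], because 2 j + 1 <= 2 (j + 1), and the sum of [r] is
    bounded by telescoping. *)
Lemma negative_binomial_moment_le N : (2 * N + 6 <= n)%N ->
  (\int[mu]_(x in S)
     \sum_(0 <= k <oo) ('C(N + k, N)%:R * (x i ^+ 2) ^+ k)%:E <= n%:R%:E)%E.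
Proof.
move=> Nn; pose a k : R := 'C(N + k, N)%:R.
rewrite (eq_integral (fun x : vec R n =>
    (\sum_(0 <= k <oo) (a k * x i ^+ (2 * k))%:E)%E)); last first.
  by move=> x _; apply: eq_eseriesr => k _; rewrite exprM.
apply: sphere_series_le => // L.
pose r k : R := \prod_(j < k) ((2 * (N.+1 + j))%:R / (n + 2 * j)%:R).
have r0 k : 0 <= r k by apply: prodr_ge0 => j _; exact: divr_ge0.
have Nn' : 2 * N%:R + 6 <= n%:R :> R by rewrite -natrM -natrD ler_nat.
have tr k : a k * \prod_(j < k) ((2 * j + 1)%:R / (n + 2 * j)%:R) <= r k.
  elim: k => [|k IH]; first by rewrite /a /r !big_ord0 addn0 binn mulr1.
  rewrite /r !big_ord_recr/= -/(r k).
  have -> : a k.+1 = a k * ((N.+1 + k)%:R / k.+1%:R).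
    apply: (@mulIf _ k.+1%:R); first by rewrite pnatr_eq0.
    rewrite -mulrA divfK ?pnatr_eq0// /a -!natrM; congr (_%:R).
    have e1 : 'C(N + k, k) = 'C(N + k, N) by rewrite -bin_sub ?leq_addl// addnK.
    have e2 : 'C((N + k).+1, k.+1) = 'C(N + k.+1, N).
      by rewrite -[RHS]bin_sub ?leq_addr// addKn addnS.
    by have := mul_bin_diag (N + k).+1 k; rewrite /= e1 e2 addSn => e; lia.
  rewrite mulrACA; apply: ler_pM => //.
  - by apply: mulr_ge0 => //; apply: prodr_ge0 => j _; exact: divr_ge0.
  rewrite mulf_div ler_pdivrMr ?mulr_gt0// [X in _ <= _ * X]mulrC mulrA divfK ?gt_eqF//.
  rewrite -!natrM ler_nat; nia.
apply: le_trans (ler_sum _ (fun k _ => tr _)) _.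
(* Adding [r L] to the sum is paid for by the decrease of the second summand: this is N + L + 2 <=
   (n + 2 L - 2) / 2, that is 2 N + 6 <= n. *)
suff H : \sum_(k < L) r k + r L * ((n%:R + 2 * L%:R - 2) / 2) <= (n%:R - 2) / 2.
  apply: le_trans (_ : (n%:R - 2) / 2 <= _); last by have := ler0n R n; lra.
  apply: le_trans H; rewrite lerDl mulr_ge0// divr_ge0//.
  by have := ler0n R L; have := ler0n R N; lra.
elim: L => [|L]; first by rewrite big_ord0 add0r /r big_ord0 mul1r mulr0 addr0.
apply: le_trans; rewrite big_ord_recr/= -addrA lerD2l.
have -> : r L.+1 = r L * ((2 * (N.+1 + L))%:R / (n + 2 * L)%:R).
  by rewrite /r big_ord_recr.
rewrite -mulrA -{1}[r L]mulr1 -mulrDr; apply: ler_wpM2l => //.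
have -> : n%:R + 2 * L.+1%:R - 2 = (n + 2 * L)%:R :> R.
  by rewrite natrD natrM -natr1; ring.
rewrite mulrA divfK ?gt_eqF// natrM natrD -[N.+1%:R]natr1.
lra.
Qed.

Lemma overlap_moment_le k (beta delta eta : R) : (3 <= k)%N ->
  0 < delta <= 1 -> 0 < eta < 1 -> beta ^+ 2 * eta < 1 ->
  (forall q, 0 < q < 1 -> beta ^+ 2 * q ^+ k <= (1 - delta) * - ln (1 - q ^+ 2)) ->
  (6 <= n)%N -> 16 <= n%:R * delta ->
  (\int[mu]_(x in S) (expR (n%:R * beta ^+ 2 / 2 * x i ^+ k))%:E <=
   ((1 - beta ^+ 2 * eta)^-1 +
    n%:R * expR (- (n%:R * (delta * - ln (1 - eta ^+ 2) / 4))))%:E)%E.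
Proof.
move=> k3 /andP[d0 d1] /andP[e0 e1] be gap n6 nd.
set lambda := - ln (1 - eta ^+ 2); set w := expR (- _).
(* The largest order with 2 N + 6 <= n; it still satisfies N + 1 >= n / 2 - 4. *)
pose N := (n./2 - 3)%N.
have N1 : (2 * N + 6 <= n)%N by rewrite /N; lia.
have N2 : n%:R / 2 - 4 <= N.+1%:R :> R.
  have : (n <= 2 * N.+1 + 8)%N by rewrite /N; lia.
  by rewrite -(ler_nat R) natrD natrM; lra.
have b20 := sqr_ge0 beta.
have e20 : 0 < 1 - eta ^+ 2 by rewrite subr_gt0 exprn_ilt1// ltW.
pose F (x : vec R n) := (\sum_(0 <= j <oo) ('C(N + j, N)%:R * (x i ^+ 2) ^+ j)%:E)%E.
have F0 x : (0 <= F x)%E.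
  by apply: nneseries_ge0 => j _ _; rewrite lee_fin mulr_ge0// exprn_ge0// sqr_ge0.
have mi := @measurable_coord R 'I_n i.
have mF : measurable_fun [set: vec R n] F.
  apply: ge0_emeasurable_sum => [j x _ _|j _].
    by rewrite lee_fin mulr_ge0// exprn_ge0// sqr_ge0.
  apply/measurable_EFinP; apply: measurable_funM => //.
  by apply: measurable_funX; apply: measurable_funX.
have mexp (a : R) m : measurable_fun [set: vec R n]
    (fun x : vec R n => (expR (a * x i ^+ m))%:E).
  apply/measurable_EFinP; apply: measurableT_comp => //.
  by apply: measurable_funM => //; exact: measurable_funX.
have mS := @measurable_unit_sphere R n.
have w0 : 0 <= w by exact: expR_ge0.
(* Pointwise majorant: the first term serves |q| <= eta, the second |q| > eta. *)
apply: (@le_trans _ _ (\int[mu]_(x in S)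
    ((expR (n%:R * (beta ^+ 2 * eta) / 2 * x i ^+ 2))%:E + w%:E * F x))%E).
  apply: ge0_le_integral => //.
  - exact: measurable_funTS.
  - apply: measurable_funTS; apply: emeasurable_funD => //.
    by apply: emeasurable_funM.
  move=> x Sx; set q := x i.
  have q1 : `|q| <= 1 by exact: unit_sphere_coord_le1.
  have qk : q ^+ k <= `|q| ^+ k by rewrite -normrX ler_norm.
  have [qe|qe] := leP `|q| eta.
    rewrite -[leLHS]adde0; apply: leeD; last by rewrite mule_ge0// lee_fin.
    rewrite lee_fin ler_expR.
    rewrite (_ : _ / 2 * q ^+ k = n%:R / 2 * beta ^+ 2 * q ^+ k); last by ring.
    rewrite (_ : _ / 2 * q ^+ 2 = n%:R / 2 * beta ^+ 2 * (eta * q ^+ 2)); last by ring.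
    apply: ler_wpM2l; first by rewrite mulr_ge0// divr_ge0.
    apply: le_trans qk _; rewrite -[q ^+ 2]real_normK ?num_real//.
    (* Since k >= 3, a factor |q| <= eta is left over beside the square. *)
    have -> : `|q| ^+ k = `|q| ^+ (k - 3) * `|q| * `|q| ^+ 2.
      by rewrite -exprSr -exprD; congr (_ ^+ _); rewrite addSnnS subnK.
    apply: ler_wpM2r; first exact: sqr_ge0.
    by apply: le_trans qe; rewrite ler_piMl// exprn_ile1.
  rewrite -[leLHS]add0e; apply: leeD; first by rewrite lee_fin expR_ge0.
  set A := n%:R * beta ^+ 2 / 2 * q ^+ k.
  set B := n%:R * (delta * lambda / 4).
  have -> : (expR A)%:E = (w%:E * (expR (A + B))%:E)%E.
    by rewrite -EFinM /w -expRD; congr (expR _)%:E; rewrite /B; ring.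
  apply: lee_wpmul2l; first by rewrite lee_fin.
  have q2 : q ^+ 2 = `|q| ^+ 2 by rewrite real_normK ?num_real.
  apply: le_negative_binomial.
    by rewrite sqr_ge0/= q2 exprn_ile1.
  have [q1'|q1'] := ltP `|q| 1; last first.
    have q11 : `|q| = 1 by apply/eqP; rewrite eq_le q1.
    by rewrite q2 q11 expr1n subrr expr0n mulr0 ler01.
  have q01 : 0 < `|q| < 1 by rewrite q1' (lt_trans e0).
  have [q20 q21] := andP (sqr_in01 q01).
  have lq : 1 - q ^+ 2 = expR (- - ln (1 - q ^+ 2)).
    by rewrite opprK lnK// posrE subr_gt0 q2.
  have lam : lambda <= - ln (1 - q ^+ 2).
    rewrite lerN2 ler_ln ?posrE//; last by rewrite q2 subr_gt0.
    by rewrite lerD2l lerN2 q2 lerXn2r ?nnegrE// ltW.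
  have l0 : 0 < lambda.
    apply: lt_le_trans (_ : eta ^+ 2 <= _); first by rewrite exprn_gt0.
    by apply: ln_1Bx_ge; rewrite -subr_gt0.
  have G : beta ^+ 2 * `|q| ^+ k <= (1 - delta) * - ln (1 - q ^+ 2).
    by have := gap _ q01; rewrite -q2.
  have AG : A <= n%:R / 2 * ((1 - delta) * - ln (1 - q ^+ 2)).
    apply: le_trans (ler_wpM2l _ G); last by rewrite divr_ge0.
    rewrite /A (_ : _ * beta ^+ 2 / 2 * _ = n%:R / 2 * (beta ^+ 2 * q ^+ k)); last by ring.
    by rewrite ler_wpM2l ?divr_ge0// ler_wpM2l.
  (* With l = -ln(1 - q^2), the exponent is at most l (n (1 - delta) / 2 + n delta / 4 - (n / 2 -
     4)) = l (4 - n delta / 4), nonpositive since n delta >= 16. *)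
  rewrite lq -expRM_natl -expRD -[leRHS]expR0 ler_expR {}/B.
  move: AG lam; move: (- ln (1 - q ^+ 2)) => l AG lam.
  have l0' : 0 <= l by apply: le_trans lam; exact: ltW.
  have H1 : n%:R * (delta * lambda / 4) <= n%:R * (delta * l / 4).
    by rewrite ler_wpM2l// ler_wpM2r// ler_wpM2l// ltW.
  have H2 := ler_wpM2r l0' N2.
  have H3 := ler_wpM2r l0' nd.
  lra.
rewrite ge0_integralD//.
- rewrite EFinD; apply: leeD; first by apply: exp_sqr_moment_le; rewrite be mulr_ge0// ltW.
  rewrite ge0_integralZl ?lee_fin//.
  + rewrite muleC EFinM; apply: lee_wpmul2r; first by rewrite lee_fin.
    exact: negative_binomial_moment_le.
  + exact: measurable_funTS.
- exact: measurable_funTS.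
- by move=> x _; rewrite mule_ge0// lee_fin.
- apply: measurable_funTS; exact: emeasurable_funM.
Qed.

End overlap.

Lemma overlap_moment_cvg (R : realType) (k : nat) (beta e : R) : (3 <= k)%N ->
  0 <= beta -> beta < beta2nd R k -> 0 < e ->
  exists n0, forall n, (n0 <= n)%N ->
    forall (mu : probability (vec R n) R) (i : 'I_n), uniform_on_sphere mu ->
    (\int[mu]_(x in @unit_sphere R n) (expR (n%:R * beta ^+ 2 / 2 * x i ^+ k))%:E <=
     (1 + e)%:E)%E.
Proof.
move=> k3 b0 bb e0; have [delta d01 gap] := beta2nd_gap b0 bb.
have [d0 _] := andP d01; have b20 := sqr_ge0 beta.
have e2 : 0 < 2 + e by lra.
have b1 : 0 < 1 + beta ^+ 2 by lra.
(* [s] solves 1 / (1 - s) = 1 + e / 2, and [eta] is chosen with beta^2 eta <= s. The other e / 2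
   absorbs the exponentially small term. *)
pose s := e / (2 + e); have s0 : 0 < s by rewrite divr_gt0.
have s1 : s < 1 by rewrite ltr_pdivrMr//; lra.
pose eta := s / (1 + beta ^+ 2); have eta0 : 0 < eta by rewrite divr_gt0.
have eta1 : eta < 1 by rewrite ltr_pdivrMr//; nra.
have bs : beta ^+ 2 * eta <= s by rewrite mulrA ler_pdivrMr//; nra.
pose c := delta * - ln (1 - eta ^+ 2) / 4.
have c0 : 0 < c.
  have [h0 h1] := andP (@sqr_in01 R eta (introT andP (conj eta0 eta1))).
  by rewrite divr_gt0// mulr_gt0// (lt_le_trans h0)// ln_1Bx_ge.
have [n1 n1P] := mulr_expRN_cvg c0 (divr_gt0 e0 (ltr0Sn R 1)).
exists (maxn n1 (maxn 6 (Num.truncn (16 / delta)).+1)) => n.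
rewrite !geq_max => /and3P[n1n n6 nd] mu i mu_unif.
apply: le_trans (overlap_moment_le (eta := eta) mu_unif i k3 d01 _ _ gap n6 _) _.
- by rewrite eta0 eta1.
- exact: le_lt_trans s1.
- by rewrite -ler_pdivrMr// ltW// (lt_le_trans (truncnS_gt _))// ler_nat.
rewrite lee_fin [in leRHS](splitr e) addrA; apply: lerD; last exact: n1P.
rewrite -(invrK (1 + e / 2)) lef_pV2 ?posrE ?invr_gt0 ?subr_gt0.
- rewrite (_ : (1 + e / 2)^-1 = 1 - s); first by lra.
  by rewrite /s; field; rewrite !gt_eqF//; lra.
- exact: le_lt_trans s1.
- by lra.
Qed.

(** * The second moment method for a mixture *)

Section second_moment.
Local Open Scope ereal_scope.
Context (R : realType) d1 d2 (X : measurableType d1) (Y : measurableType d2).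
Variables (mu : probability X R) (g : probability Y R) (H : X * Y -> R).
Hypothesis mH : measurable_fun [set: X * Y] H.
Hypothesis H0 : forall z, (0 <= H z)%R.

Let L y := \int[mu]_x (H (x, y))%:E.

Let mHE : measurable_fun [set: X * Y] (EFin \o H).
Proof. exact/measurable_EFinP. Qed.

Let H0E z : 0 <= (EFin \o H) z. Proof. by rewrite lee_fin. Qed.

Let L0 y : 0 <= L y. Proof. by apply: integral_ge0 => x _; rewrite lee_fin. Qed.

Let mL : measurable_fun [set: Y] L.
Proof. exact: (measurable_fun_fubini_tonelli_G _ mHE H0E). Qed.

Let mH1 x : measurable_fun [set: Y] (fun y => H (x, y)).
Proof. exact: measurableT_comp. Qed.

Let mH2 y : measurable_fun [set: X] (fun x => H (x, y)).
Proof. exact: measurableT_comp. Qed.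

Let integral_mixture B : measurable B ->
  \int[mu]_x \int[g]_(y in B) (H (x, y))%:E = \int[g]_y ((\1_B y)%:E * L y).
Proof.
move=> mB; pose f (z : X * Y) := (\1_B z.2 * H z)%R%:E.
have mf : measurable_fun [set: X * Y] f.
  apply/measurable_EFinP; apply: measurable_funM => //.
  by apply: (measurableT_comp _ measurable_snd); exact: measurable_indic.
have f0 z : 0 <= f z by rewrite lee_fin mulr_ge0.
transitivity (\int[mu]_x \int[g]_y f (x, y)).
  apply: eq_integral => x _; rewrite integral_mkcond; apply: eq_integral => y _.
  by rewrite patchE /f /= indicE; case: ifP; rewrite ?mul1r ?mul0r.
rewrite fubini_tonelli//; apply: eq_integral => y _.
rewrite /f /L -ge0_integralZl ?lee_fin//.
- by apply/measurable_EFinP.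
- by move=> x _; rewrite lee_fin.
Qed.

(** The square of a mixture is an integral over two independent copies x and x'; Tonelli moves the
    integral over y inside. *)
Let integral_sqr : \int[g]_y (L y * L y) =
  \int[mu]_x \int[mu]_x' \int[g]_y (H (x, y) * H (x', y))%:E.
Proof.
pose f (z : X * Y) := (H z)%:E * L z.2.
have mf : measurable_fun [set: X * Y] f.
  by apply: emeasurable_funM => //; exact: (measurableT_comp mL measurable_snd).
have f0 z : 0 <= f z by rewrite mule_ge0// lee_fin.
transitivity (\int[g]_y \int[mu]_x f (x, y)).
  apply: eq_integral => y _; rewrite /f /= ge0_integralZr//.
  - by apply/measurable_EFinP.
  - by move=> x _; rewrite lee_fin.
rewrite -fubini_tonelli//; apply: eq_integral => x _; rewrite /f /=.
pose h (z : X * Y) := (H (x, z.2) * H z)%:E.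
have mh : measurable_fun [set: X * Y] h.
  apply/measurable_EFinP; apply: measurable_funM => //.
  exact: (measurableT_comp (mH1 x) measurable_snd).
have h0 z : 0 <= h z by rewrite lee_fin mulr_ge0.
transitivity (\int[g]_y \int[mu]_x' h (x', y)).
  apply: eq_integral => y _; rewrite /h /= /L -ge0_integralZl ?lee_fin//.
  - by apply/measurable_EFinP.
  - by move=> x' _; rewrite lee_fin.
by rewrite -fubini_tonelli.
Qed.

Hypothesis H1 : \int[mu]_x \int[g]_y (H (x, y))%:E = 1.

(* Integrates [2 (l - 1) <= t + (l - 1)^2 / t] over [B], where [l = L y] is
   the likelihood ratio. *)
Lemma second_moment_bound (M t : R) B : measurable B -> (0 < t)%R ->
  \int[mu]_x \int[mu]_x' \int[g]_y (H (x, y) * H (x', y))%:E <= M%:E ->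
  \int[mu]_x \int[g]_(y in B) (H (x, y))%:E <=
  g B + (t / 2 * fine (g B) + (M - 1) / (2 * t))%:E.
Proof.
move=> mB t0; rewrite -integral_sqr integral_mixture// => LM.
have L1 : \int[g]_y L y = 1.
  rewrite -H1 integral_mixture//; apply: eq_integral => y _.
  by rewrite indicT mul1e.
set Q := \int[g]_y _.
have Q1 : Q <= 1.
  rewrite -L1; apply: ge0_le_integral => //.
  - by move=> y _; rewrite mule_ge0 ?lee_fin.
  - by apply: emeasurable_funM => //; apply/measurable_EFinP.
  - move=> y _; rewrite -[leRHS]mul1e; apply: lee_wpmul2r => //.
    by rewrite lee_fin indicE; case: (y \in B).
have Q0 : 0 <= Q by apply: integral_ge0 => y _; rewrite mule_ge0 ?lee_fin.
have t2 : (0 <= 2 / t)%R by rewrite divr_ge0// ltW.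
have t1 : (0 <= t^-1)%R by rewrite invr_ge0 ltW.
(* Arranged without subtraction, so that it makes sense where [L] is infinite. *)
have key : 2%:E * Q + (2 / t)%:E <= (2 + t)%:E * g B + (t^-1)%:E * (M + 1)%:E.
  have mBL : measurable_fun [set: Y] (fun y => (\1_B y)%:E * L y).
    by apply: emeasurable_funM => //; apply/measurable_EFinP.
  have BL0 y : 0 <= (\1_B y)%:E * L y by rewrite mule_ge0 ?lee_fin.
  have mLL : measurable_fun [set: Y] (fun y => L y * L y).
    exact: emeasurable_funM.
  have LL0 y : 0 <= L y * L y by rewrite mule_ge0.
  apply: (@le_trans _ _ (\int[g]_y
      (2%:E * ((\1_B y)%:E * L y) + (2 / t)%:E * L y))).
    rewrite ge0_integralD//.
    - by rewrite !ge0_integralZl ?lee_fin// L1 mule1.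
    - by move=> y _; rewrite mule_ge0 ?lee_fin.
    - exact: measurable_funeM.
    - by move=> y _; rewrite mule_ge0 ?lee_fin.
    - exact: measurable_funeM.
  apply: (@le_trans _ _ (\int[g]_y
      ((2 + t)%:E * (\1_B y)%:E + (t^-1)%:E * (L y * L y + 1)))).
    have m1B : measurable_fun [set: Y] (fun y => (\1_B y : R)%:E).
      by apply/measurable_EFinP.
    apply: ge0_le_integral => //.
    - by move=> y _; rewrite adde_ge0// mule_ge0 ?lee_fin.
    - by apply: emeasurable_funD; exact: measurable_funeM.
    - apply: emeasurable_funD; apply: measurable_funeM => //.
      exact: emeasurable_funD.
    move=> y _; have := L0 y; case: (L y) => [l l0| |//]; last first.
      move=> _; rewrite [leRHS](_ : _ = +oo) ?leey//.
      by rewrite mulyy addye// gt0_muley ?lte_fin ?invr_gt0// -EFinM addey.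
    rewrite -!(EFinM, EFinD) lee_fin.
    (* The right side exceeds the left by (l - 1 - t)^2 / t on [B] and by (l - 1)^2 / t off [B]. *)
    rewrite indicE; case: (y \in B) => /=.
      have : (0 <= t^-1 * (l - 1 - t) ^+ 2)%R by rewrite mulr_ge0// sqr_ge0.
      rewrite (_ : t^-1 * _ = t^-1 * (l * l + 1) - 2 / t * l - 2 * (l - 1) + t)%R.
        lra.
      by field; rewrite gt_eqF.
    have : (0 <= t^-1 * (l - 1) ^+ 2)%R by rewrite mulr_ge0// sqr_ge0.
    rewrite (_ : t^-1 * _ = t^-1 * (l * l + 1) - 2 / t * l)%R; first by lra.
    by field; rewrite gt_eqF.
  rewrite ge0_integralD//.
  - rewrite !ge0_integralZl ?lee_fin// ?addr_ge0 ?(ltW t0)//.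
    + rewrite integral_indic// setIT; apply: leeD => //.
      apply: lee_wpmul2l; first by rewrite lee_fin.
      rewrite ge0_integralD// integral_cst//.
      rewrite [X in _ + 1 * X](@probability_setT _ _ _ g) mule1 EFinD.
      exact: leeD.
    + exact: emeasurable_funD.
    + by move=> y _; rewrite adde_ge0.
    + by apply/measurable_EFinP.
  - by move=> y _; rewrite mule_ge0 ?lee_fin// addr_ge0// ltW.
  - by apply: measurable_funeM; apply/measurable_EFinP.
  - by move=> y _; rewrite mule_ge0 ?lee_fin// adde_ge0.
  - by apply: measurable_funeM; exact: emeasurable_funD.
have gfin : g B \is a fin_num by exact: fin_num_measure.
have Qfin : Q \is a fin_num by rewrite ge0_fin_numE// (le_lt_trans Q1)// ltry.
move: key; rewrite -(fineK gfin) -(fineK Qfin) -!EFinM -!EFinD !lee_fin.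
move: (fine Q) (fine (g B)) => q p /= key.
rewrite (_ : (M - 1) / (2 * t) = (t^-1 * (M + 1) - 2 / t) / 2)%R; last by field; rewrite gt_eqF.
lra.
Qed.

End second_moment.

(** * Algebra and measurability of spiked tensors *)

Section spiked_tensors.
Context (R : realType) (k n : nat).
Implicit Types (x : vec R n) (g z : tensor R k n) (beta : R).

Let mcoord (I : finType) (i : I) : measurable_fun [set: RI R I] (fun x : RI R I => x i).
Proof. exact: measurable_coord. Qed.

Lemma measurable_outer_power : measurable_fun [set: vec R n] (@outer_power R k n).
Proof.
apply: measurable_RI => i; apply: measurable_prod => j _.
exact: mcoord.
Qed.

Lemma measurable_sym_noise : measurable_fun [set: tensor R k n] (@sym_noise R k n).
Proof.
apply: measurable_RI => i; apply: measurable_funM => //.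
by apply: measurable_sum => s; exact: mcoord.
Qed.

Lemma measurable_spiked_tensor beta :
  measurable_fun [set: vec R n * tensor R k n]
    (fun p => spiked_tensor beta p.1 p.2).
Proof.
apply: measurable_RI => i; apply: measurable_funD.
  apply: measurable_funM => //.
  have mo := measurableT_comp (mcoord i) measurable_outer_power.
  exact: (measurableT_comp mo measurable_fst).
exact: (measurableT_comp (mcoord i) measurable_snd).
Qed.

(** By distributivity, a sum over multi-indices of a product over slots is a product of k equal
    sums. *)
Lemma outer_power_dot (x x' : 'I_n -> R) :
  \sum_i outer_power (k := k) x i * outer_power (k := k) x' i =
  (\sum_l x l * x' l) ^+ k.
Proof.
under eq_bigr do rewrite /outer_power -big_split/=.
rewrite -(bigA_distr_bigA (fun (_ : 'I_k) l => x l * x' l)).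
by rewrite prodr_const card_ord.
Qed.

(* [sym_noise] fixes the symmetric tensor [outer_power x] up to the scaling
   [sqrt (2 / n)], so adding the spike amounts to a shift of [g]. *)
Lemma sym_noise_translate beta x g : (0 < n)%N ->
  sym_noise (translate (fun i => beta * Num.sqrt (n%:R / 2) * outer_power x i) g) =
  spiked_tensor beta x (sym_noise g).
Proof.
move=> n0; apply/funext => i; rewrite /sym_noise /spiked_tensor /translate /perm_tensor.
rewrite big_split/= mulrDr addrC; congr (_ + _).
(* A product over the slots does not depend on their order, so all k! permutations contribute the
   same value. *)
under eq_bigr => s _.
  rewrite (_ : outer_power x _ = outer_power x i); first over.
  rewrite /outer_power [RHS](reindex_inj (@perm_inj _ s))/=.
  by apply: eq_bigr => j _; rewrite ffunE.
rewrite sumr_const (_ : #|_| = k`!); last by rewrite -card_Sn; apply: eq_card.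
have s1 : Num.sqrt (2 / n%:R) * Num.sqrt (n%:R / 2) = 1 :> R.
  rewrite -sqrtrM ?divr_ge0// mulf_div [n%:R * _]mulrC divff ?sqrtr1//.
  by rewrite mulf_neq0// pnatr_eq0 -lt0n.
have f0 : k`!%:R != 0 :> R by rewrite pnatr_eq0 -lt0n fact_gt0.
transitivity (beta * (Num.sqrt (2 / n%:R) * Num.sqrt (n%:R / 2)) * outer_power x i).
  rewrite -[_ *+ k`!]mulr_natl.
  by move: (Num.sqrt _) (Num.sqrt _) f0 => a b f0; field.
by rewrite s1 mulr1.
Qed.

End spiked_tensors.

(** * The observation as a mixture over the spike *)

Section law_of_observation.
Context (R : realType) (k n : nat) (d : measure_display) (T : measurableType d).
Context (P : probability T R) (G : {RV P >-> tensor R k n}) (v : {RV P >-> vec R n}).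
Hypothesis model : spiked_model G v.
Local Notation mu := (distribution P v).
Local Notation gam := (distribution P G).

(** Independence makes the joint law of [v] and the noise a product measure, by uniqueness on
    rectangles. *)
Lemma spiked_law_mixture beta A : measurable A ->
  spiked_law G v beta A =
  (\int[mu]_x gam (fun g => A (spiked_tensor beta x (sym_noise g))))%E.
Proof.
move=> mA; have [_ _ indep] := model.
pose C : set (vec R n * tensor R k n) := (fun p => spiked_tensor beta p.1 p.2) @^-1` A.
have mC : measurable C.
  by rewrite -[C]setTI; exact: measurable_spiked_tensor.
pose W w : vec R n * tensor R k n := (v w, noise G w).
have mW : measurable_fun [set: T] W.
  by apply: measurable_fun_pair; exact: measurable_funP.
pose m' : {measure set (vec R n * tensor R k n) -> \bar R} :=
  measure_function_pushforward__canonical__measure_function_Measure P mW.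
have -> : spiked_law G v beta A = m' C by [].
rewrite -(@product_measure_unique _ _ _ _ _ mu (distribution P (noise G)) m').
- apply: eq_integral => x _; rewrite /= /distribution /pushforward.
  congr (P _); apply/seteqP; split => w; rewrite /xsection /= inE; exact.
- by move=> X Y mX mY; exact: indep.
- by [].
Qed.

End law_of_observation.

(** * The likelihood ratio and its second moment *)

Section likelihood_ratio.
Local Open Scope ereal_scope.
Context (R : realType) (k n : nat) (a : R).
Context (mu : probability (vec R n) R) (gam : probability (tensor R k n) R).
Hypothesis gaussian_gam : gaussian_law gam.
Hypothesis mu_unif : uniform_on_sphere mu.
Local Notation S := (@unit_sphere R n).

Let u (x : vec R n) : tensor R k n := fun i => (a * outer_power x i)%R.

(* The density of [u x + g] with respect to the law of [g], cut off outside
   of the sphere. *)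
Definition likelihood_ratio (p : vec R n * tensor R k n) : R :=
  (\1_S p.1 * expR (\sum_i (u p.1 i * p.2 i - u p.1 i ^+ 2 / 2)))%R.

Lemma likelihood_ratio_ge0 p : (0 <= likelihood_ratio p)%R.
Proof. by rewrite mulr_ge0// expR_ge0. Qed.

Lemma measurable_likelihood_ratio :
  measurable_fun [set: vec R n * tensor R k n] likelihood_ratio.
Proof.
have mS := @measurable_unit_sphere R n.
apply: measurable_funM.
  have mi : measurable_fun [set: vec R n] (\1_S : vec R n -> R).
    exact: measurable_indic.
  exact: (measurableT_comp mi measurable_fst).
apply: measurableT_comp => //; apply: measurable_sum => i.
have mu1 : measurable_fun [set: vec R n * tensor R k n] (fun p => u p.1 i).
  apply: measurable_funM => //.
  have mo := measurableT_comp (@measurable_coord R _ i) (@measurable_outer_power R k n).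
  exact: (measurableT_comp mo measurable_fst).
apply: measurable_funB.
  apply: measurable_funM => //.
  exact: (measurableT_comp (@measurable_coord R _ i) measurable_snd).
by apply: measurable_funM => //; exact: measurable_funX.
Qed.

Lemma integral_likelihood_ratio x B : S x -> measurable B ->
  \int[gam]_(g in B) (likelihood_ratio (x, g))%:E = gam (translate (u x) @^-1` B).
Proof.
move=> Sx mB.
have mt : measurable (translate (u x) @^-1` B).
  by rewrite -[X in measurable X]setTI; exact: measurable_translate.
transitivity (\int[gam]_g (\1_B (translate (u x) g))%:E).
  rewrite (@gaussian_shift _ _ _ gaussian_gam _ (fun g => (\1_B g)%:E)).
  - rewrite integral_mkcond; apply: eq_integral => g _.
    rewrite patchE /likelihood_ratio !indicE [_ \in S]mem_set// mul1r.
    by case: ifP; rewrite ?mul1e ?mul0e.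
  - by apply/measurable_EFinP; exact: measurable_indic.
  - by move=> g; rewrite lee_fin.
by rewrite -(setIT (translate _ @^-1` _)) -integral_indic.
Qed.

(** The two exponents add up to that of the shift [w], whose exponential integrates to 1, plus the
    inner product of [u x] and [u x'], which is constant in g. *)
Lemma integral_likelihood_ratio2 x x' : S x -> S x' ->
  \int[gam]_g (likelihood_ratio (x, g) * likelihood_ratio (x', g))%:E =
  (expR (a ^+ 2 * (\sum_l x l * x' l) ^+ k))%:E.
Proof.
move=> Sx Sx'; pose w : tensor R k n := fun i => (u x i + u x' i)%R.
have w1 : \int[gam]_g (expR (\sum_i (w i * g i - w i ^+ 2 / 2)))%:E = 1.
  have := @gaussian_shift _ _ _ gaussian_gam w (cst 1).
  rewrite integral_cst// [X in 1 * X](@probability_setT _ _ _ gam) mule1 => ->//.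
  by apply: eq_integral => g _; rewrite mul1e.
rewrite -[RHS]mule1 -w1 -ge0_integralZl ?lee_fin ?expR_ge0//.
- apply: eq_integral => g _; rewrite /likelihood_ratio !indicE !mem_set//= !mul1r.
  rewrite -EFinM -!expRD; congr (expR _)%:E.
  rewrite -outer_power_dot mulr_sumr -!big_split/=; apply: eq_bigr => i _.
  by rewrite /w /u; field.
- apply/measurable_EFinP; apply: measurableT_comp => //; apply: measurable_sum => i.
  apply: measurable_funB => //; apply: measurable_funM => //.
  exact: measurable_coord.
Qed.

(** For x on the sphere, the inner product with x has the law of coordinate [i0], so the inner
    integral is the same for all such x; points off the sphere contribute 0. *)
Lemma likelihood_ratio_second_moment (i0 : 'I_n) (M : R) :
  \int[mu]_(x in S) (expR (a ^+ 2 * x i0 ^+ k))%:E <= M%:E ->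
  \int[mu]_x \int[mu]_x' \int[gam]_g
    (likelihood_ratio (x, g) * likelihood_ratio (x', g))%:E <= M%:E.
Proof.
move=> MP; have mS := @measurable_unit_sphere R n.
have out x g : ~ S x -> likelihood_ratio (x, g) = 0%R.
  by move=> Sx; rewrite /likelihood_ratio indicE memNset// mul0r.
have me : measurable_fun [set: R] (fun t : R => (expR (a ^+ 2 * t ^+ k))%:E).
  apply/measurable_EFinP; apply: measurableT_comp => //.
  by apply: measurable_funM => //; exact: measurable_funX.
have me0 (t : R) : 0 <= (expR (a ^+ 2 * t ^+ k))%:E by rewrite lee_fin expR_ge0.
apply: le_trans MP; set I := (leRHS).
rewrite [leLHS](_ : _ = \int[mu]_(x in S) I).
  by rewrite integral_cst// [X in _ * X](mu_unif.1 : _ = 1) mule1.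
rewrite [RHS]integral_mkcond; apply: eq_integral => x _; rewrite patchE.
case: ifPn => [/set_mem Sx|/negP Sx]; last first.
  rewrite integral0_eq// => x' _; rewrite integral0_eq// => g _.
  by rewrite out ?mul0r// => /mem_set.
rewrite /I -(sphere_integral_dot mu_unif i0 Sx me me0) [RHS]integral_mkcond.
apply: eq_integral => x' _; rewrite patchE.
case: ifPn => [/set_mem Sx'|/negP Sx']; first exact: integral_likelihood_ratio2.
rewrite integral0_eq// => g _.
by rewrite [X in (_ * X)%R]out ?mulr0// => /mem_set.
Qed.

End likelihood_ratio.

(** * Comparison of the spiked and unspiked laws *)

Section spiked_law_bounds.
Local Open Scope ereal_scope.
Context (R : realType) (k n : nat) (d : measure_display) (T : measurableType d).
Context (P : probability T R) (G : {RV P >-> tensor R k n}) (v : {RV P >-> vec R n}).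
Hypothesis model : spiked_model G v.
Local Notation mu := (distribution P v).
Local Notation gam := (distribution P G).
Local Notation S := (@unit_sphere R n).

Let gaussian_gam : gaussian_law gam.
Proof. by apply: gaussian_law_iid; have [] := model. Qed.

Let mu_unif : uniform_on_sphere mu. Proof. by have [] := model. Qed.

Lemma spiked_law0 A : spiked_law G v 0 A = gam (@sym_noise R k n @^-1` A).
Proof.
rewrite /spiked_law /distribution /pushforward; congr (P _).
apply/seteqP; split => w /=; congr (A _); apply/funext => i;
  by rewrite /observation /spiked_tensor mul0r add0r.
Qed.

(** The spike is a shift before symmetrization, so [A] is pulled back by [sym_noise]; the cut-off is
    harmless because [mu] gives the complement of the sphere mass 0. *)
Lemma spiked_law_likelihood_ratio (beta : R) A : (0 < n)%N -> measurable A ->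
  spiked_law G v beta A = \int[mu]_x \int[gam]_(g in @sym_noise R k n @^-1` A)
    (likelihood_ratio (beta * Num.sqrt (n%:R / 2)) (x, g))%:E.
Proof.
move=> n0 mA; have mS := @measurable_unit_sphere R n.
have mB : measurable (@sym_noise R k n @^-1` A).
  by rewrite -[X in measurable X]setTI; exact: measurable_sym_noise.
rewrite spiked_law_mixture//.
set h := fun x => gam _.
have mh : measurable_fun [set: vec R n] h.
  pose C : set (vec R n * tensor R k n) :=
    (fun p => spiked_tensor beta p.1 (sym_noise p.2)) @^-1` A.
  have mC : measurable C.
    rewrite -[C]setTI.
    have mid : measurable_fun [set: vec R n * tensor R k n]
        (fun p => (p.1, sym_noise p.2)).
      apply: measurable_fun_pair; first exact: measurable_fst.
      exact: (measurableT_comp (@measurable_sym_noise R k n) measurable_snd).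
    exact: (measurableT_comp (@measurable_spiked_tensor R k n beta) mid).
  have := @measurable_fun_xsection _ _ _ _ _ gam _ mC.
  congr (measurable_fun _ _); apply/funext => x; rewrite /h /=; congr (gam _).
  by apply/seteqP; split => g; rewrite /xsection /= inE.
have mSC : mu (~` S) = 0.
  by rewrite probability_setC// [X in 1 - X](mu_unif.1 : _ = 1) subee.
rewrite (@ge0_negligible_integral _ _ _ mu setT (~` S))//; last exact: measurableC.
rewrite setTD setCK integral_mkcond; apply: eq_integral => x _; rewrite patchE.
case: ifPn => [/set_mem Sx|/negP Sx].
  rewrite integral_likelihood_ratio//; congr (gam _).
  by apply/seteqP; split => g /=; rewrite sym_noise_translate.
rewrite integral0_eq// => g _; rewrite /likelihood_ratio indicE memNset ?mul0r//.
by move=> /mem_set.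
Qed.

Lemma spiked_law_le (beta M t : R) (i0 : 'I_n) A : measurable A -> (0 < t)%R ->
  \int[mu]_(x in S) (expR (n%:R * beta ^+ 2 / 2 * x i0 ^+ k))%:E <= M%:E ->
  spiked_law G v beta A <= spiked_law G v 0 A +
    (t / 2 * fine (spiked_law G v 0 A) + (M - 1) / (2 * t))%:E.
Proof.
move=> mA t0 MP; have n0 : (0 < n)%N := leq_ltn_trans (leq0n i0) (ltn_ord i0).
have mB : measurable (@sym_noise R k n @^-1` A).
  by rewrite -[X in measurable X]setTI; exact: measurable_sym_noise.
rewrite spiked_law_likelihood_ratio// !spiked_law0.
apply: second_moment_bound => //.
- exact: measurable_likelihood_ratio.
- exact: likelihood_ratio_ge0.
- rewrite -(spiked_law_likelihood_ratio beta n0 measurableT).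
  exact: probability_setT.
- apply: (likelihood_ratio_second_moment gaussian_gam mu_unif (i0 := i0)).
  apply: le_trans MP; rewrite le_eqVlt; apply/orP; left; apply/eqP.
  apply: eq_integral => x _; congr (expR (_ * _))%:E.
  by rewrite exprMn sqr_sqrtr ?divr_ge0//; ring.
Qed.

(** The one-sided bound, applied to an event and to its complement, controls the absolute
    difference. *)
Lemma tv_dist_spiked_le (beta M t : R) (i0 : 'I_n) : (0 < t)%R ->
  \int[mu]_(x in S) (expR (n%:R * beta ^+ 2 / 2 * x i0 ^+ k))%:E <= M%:E ->
  tv_dist (spiked_law G v beta) (spiked_law G v 0) <=
    (t / 2 + (M - 1) / (2 * t))%:E.
Proof.
move=> t0 MP; apply: ub_ereal_sup => _ [A /= mA <-].
have fb b B : measurable B -> spiked_law G v b B \is a fin_num.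
  by move=> mB; exact: fin_num_measure.
have bound B : measurable B ->
    (fine (spiked_law G v beta B) - fine (spiked_law G v 0 B) <=
     t / 2 + (M - 1) / (2 * t))%R.
  move=> mB; have := spiked_law_le mB t0 MP.
  rewrite -{1}(fineK (fb beta B mB)) -{1}(fineK (fb 0%R B mB)) -EFinD lee_fin => h.
  rewrite lerBlDl; apply: le_trans h _; rewrite lerD2l lerD2r ler_piMr ?divr_ge0 ?(ltW t0)//.
  by rewrite -lee_fin fineK ?fb// probability_le1.
have fC b : (fine (spiked_law G v b (~` A)) = 1 - fine (spiked_law G v b A))%R.
  by rewrite probability_setC// fineB ?fb.
rewrite -(fineK (fb beta A mA)) -(fineK (fb 0%R A mA)) -EFinB abse_EFin lee_fin.
rewrite ler_norml bound// andbT.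
have := bound _ (measurableC mA); rewrite !fC; lra.
Qed.

End spiked_law_bounds.

(** * Limits and conclusion *)

Lemma ereal_cvg0 (R : realType) (f : nat -> \bar R) : (forall n, (0 <= f n)%E) ->
  (forall e : R, 0 < e -> exists n0, forall n, (n0 <= n)%N -> (f n <= e%:E)%E) ->
  f n @[n --> \oo] --> 0%E.
Proof.
move=> f0 fe; apply/fine_cvgP; split.
  have [n0 n0P] := fe 1 ltr01; near=> n.
  rewrite ge0_fin_numE//; apply: le_lt_trans (n0P n _) (ltry _).
  by near: n; exists n0.
apply/cvgrPdist_le => e e0; have [n0 n0P] := fe e e0.
near=> n; have fn : (f n <= e%:E)%E by apply: n0P; near: n; exists n0.
rewrite /= sub0r normrN ger0_norm ?fine_ge0//.
by rewrite -lee_fin fineK// ge0_fin_numE// (le_lt_trans fn)// ltry.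
Unshelve. all: by end_near. Qed.

Theorem theorem3 (R : realType) :
  beta2nd R 2 = 1 /\
  forall (k : nat) (beta : R)
    (d : nat -> measure_display) (Omega : forall n, measurableType (d n))
    (P : forall n, probability (Omega n) R)
    (G : forall n, {RV P n >-> tensor R k n})
    (v : forall n, {RV P n >-> vec R n}),
    (2 <= k)%N -> 0 <= beta -> beta < beta2nd R k ->
    (forall n, (0 < n)%N -> spiked_model (G n) (v n)) ->
    ((3 <= k)%N ->
      tv_dist (spiked_law (G n) (v n) beta) (spiked_law (G n) (v n) 0)
        @[n --> \oo] --> 0%E) /\
    (k = 2%N ->
      contiguous (fun n => spiked_law (G n) (v n) beta)
                 (fun n => spiked_law (G n) (v n) 0)).
Proof.
split; first exact: beta2nd2.
move=> k beta d Omega P G v k2 b0 bb model; split.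
  move=> k3; apply: ereal_cvg0 => [n|e e0].
    apply: (@le_trans _ _ `|spiked_law (G n) (v n) beta set0 -
        spiked_law (G n) (v n) 0 set0|%E); first exact: abse_ge0.
    by apply: ereal_sup_ubound; exists set0 => //; exact: measurable0.
  (* With M = 1 + e^2 and t = e the bound t / 2 + (M - 1) / (2 t) is exactly e. *)
  have [n0 n0P] := overlap_moment_cvg k3 b0 bb (exprn_gt0 2 e0).
  (* The successor excludes dimension 0, for which no model is assumed. *)
  exists n0.+1 => -[//|n] n0n.
  have md := model n.+1 isT; have [_ mu_unif _] := md.
  have := tv_dist_spiked_le md e0 (n0P _ (ltnW n0n) _ ord0 mu_unif).
  rewrite (_ : e / 2 + (1 + e ^+ 2 - 1) / (2 * e) = e)//.
  by field; rewrite gt_eqF.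
move=> k_eq2; subst k; rewrite beta2nd2 in bb => A mA /fine_cvgP[_ /cvgrPdist_le P0A].
have b2 : 0 <= beta ^+ 2 < 1 by rewrite sqr_ge0 exprn_ilt1.
pose M := (1 - beta ^+ 2)^-1.
have M0 : 0 < M by rewrite invr_gt0 subr_gt0; case/andP: b2.
apply: ereal_cvg0 => [n|e e0]; first exact: measure_ge0.
(* This [t] makes (M - 1) / (2 t) less than e / 2, and P_0(A) <= e / (2 + t) makes (1 + t / 2)
   P_0(A) at most e / 2. *)
pose t := M / e; have t0 : 0 < t by rewrite divr_gt0.
have e'0 : 0 < e / (2 + t) by rewrite divr_gt0// addr_gt0.
have [n0 _ n0P] := P0A _ e'0.
exists n0.+1 => -[//|n] n0n.
have md := model n.+1 isT; have [_ mu_unif _] := md.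
apply: le_trans (spiked_law_le md (mA _) t0 (exp_sqr_moment_le mu_unif ord0 b2)) _.
have f0 : spiked_law (G n.+1) (v n.+1) 0 (A n.+1) \is a fin_num by exact: fin_num_measure.
have := n0P n.+1 (ltnW n0n); rewrite /= sub0r normrN ger0_norm ?fine_ge0//.
rewrite -{2}(fineK f0) -EFinD lee_fin -/M.
move: (fine _) => p.
rewrite ler_pdivlMr ?addr_gt0// => pe.
have -> : (M - 1) / (2 * t) = e / 2 - e / (2 * M).
  by rewrite /t; field; rewrite !gt_eqF.
have : 0 < e / (2 * M) by rewrite divr_gt0// mulr_gt0.
lra.
Qed.
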